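(* Let $g_1,\dots,g_t\in\mathbb{R}[x_1,\dots,x_n]$ and suppose $K=\{x\in\mathbb{R}^n: g_1(x)\geq0,\dots,g_t(x)\geq0\}$. Assume there exist positive integers $N,e$ such that $N-\|x\|_2^2\in Q_e(g_1,\dots,g_t)$. Let $V\subseteq\mathbb{R}[x_1,\dots,x_n]$ be a finite-dimensional subspace with basis $\phi_1,\dots,\phi_T$ and write $\vec\phi=(\phi_1,\dots,\phi_T)$. Let $\delta\geq0$ and let $y\in\mathbb{R}^T$ have components $y_i=\int_K\phi_i\,d\mu+\epsilon_i$, where $\mu$ is a positive discrete measure on $K$ and $\|\epsilon\|_2\leq\delta$. For each positive integer $s$ let $$\alpha_s:=\sup_{(\vec a,b)\in\mathbb{R}^T\times\mathbb{R}}\left\{\langle\vec a,y\rangle-b\delta\ :\ 1-\langle\vec a,\vec\phi\rangle\in Q_s(g_1,\dots,g_t),\ 1+\langle\vec a,\vec\phi\rangle\in Q_s(g_1,\dots,g_t),\ \|\vec a\|_2\leq b\right\}.$$ Then: 1. For each $s$ the number $\alpha_s$ is the optimal value of a semidefinite programming problem. 2. $\lim_{s\to\infty}\alpha_s=\alpha$, where $$\alpha:=\sup_{(\vec a,b)\in\mathbb{R}^T\times\mathbb{R}}\left\{\langle\vec a,y\rangle-b\delta\ :\ P=\sum_{i=1}^T a_i\phi_i,\ \|P\|_\infty\leq1,\ \|\vec a\|_2\leq b\right\}.$$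
   Context: For $e\in\mathbb{Z}_+$, the quadratic module of degree $e$ of $g_1,\dots,g_t$ is $$Q_e(g_1,\dots,g_t)=\left\{f\in\mathbb{R}[x_1,\dots,x_n]: f=s_0+\sum_{i=1}^t g_is_i\ \text{for some } s_0,\dots,s_t\right\},$$ where each $s_i\in\mathbb{R}[x_1,\dots,x_n]$ is a sum of squares of polynomials of degree at most $e$. $\|P\|_\infty$ denotes the supremum norm of $P$ on $K$. A positive discrete measure on $K$ is a finite combination of Dirac measures at points of $K$ with nonnegative coefficients. $\langle\vec a,\vec\phi\rangle=\sum_i a_i\phi_i$. *)

(* Defs.v *)
From HB Require Import structures.
From mathcomp Require Import all_boot all_order all_algebra.
(* Without its notations, which clash with those of mathcomp-analysis. *)
From mathcomp Require Import(canonicals, coercions) mpoly.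
From mathcomp Require Import all_classical all_reals all_analysis.

Set Implicit Arguments.
Unset Strict Implicit.
Unset Printing Implicit Defensive.

Import Order.TTheory GRing.Theory Num.Theory.
Import numFieldNormedType.Exports.

Local Open Scope classical_set_scope.
Local Open Scope ring_scope.

Notation mpol R n := (mpoly.mpoly n R).

(* Points of R^n are tuples: [n.-tuple R] carries the product of the Borel
   sigma-algebras, i.e. the Borel sigma-algebra of R^n. *)
Definition peval {R : realType} {n : nat} (p : mpol R n) (x : n.-tuple R) : R :=
  mpoly.meval (tnth x) p.

Definition pvar (R : realType) (n : nat) (i : 'I_n) : mpol R n :=
  mpoly.mpolyX R (mpoly.mnm1 i).

Definition sqnorm_poly (R : realType) (n : nat) : mpol R n :=
  \sum_(i < n) pvar R i ^+ 2.

(* [mpoly.msize p] is the degree of p plus one, and 0 for p = 0. *)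
Definition sos {R : realType} {n : nat} (e : nat) (p : mpol R n) : Prop :=
  exists2 l : seq (mpol R n),
    all (fun h => (mpoly.msize h <= e.+1)%N) l & p = \sum_(h <- l) h ^+ 2.

Definition quad_module {R : realType} {n t : nat} (e : nat)
    (g : 'I_t -> mpol R n) : set (mpol R n) :=
  [set f | exists (s0 : mpol R n) (s : 'I_t -> mpol R n),
     [/\ sos e s0, forall i, sos e (s i) & f = s0 + \sum_(i < t) g i * s i]].

Definition lin_comb {R : realType} {n T : nat} (a : 'rV[R]_T)
    (phi : 'I_T -> mpol R n) : mpol R n :=
  \sum_(i < T) a 0 i *: phi i.

Definition is_basis {R : realType} {n T : nat} (V : set (mpol R n))
    (phi : 'I_T -> mpol R n) : Prop :=
  V = [set lin_comb a phi | a in setT] /\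
  forall a : 'rV[R]_T, lin_comb a phi = 0 -> a = 0.

Definition norm2 {R : realType} {T : nat} (a : 'rV[R]_T) : R :=
  Num.sqrt (\sum_(i < T) a 0 i ^+ 2).

Definition sup_norm {R : realType} {n : nat} (K : set (n.-tuple R))
    (P : mpol R n) : \bar R :=
  ereal_sup [set (`|peval P x|)%:E | x in K].

Definition positive_discrete {R : realType} {n : nat} (K : set (n.-tuple R))
    (mu : {measure set (n.-tuple R) -> \bar R}) : Prop :=
  exists (m : nat) (c : 'I_m -> R) (x : 'I_m -> n.-tuple R),
    [/\ forall j, 0 <= c j, forall j, K (x j) &
        forall A, measurable A ->
          mu A = (\sum_(j < m) (c j)%:E * \d_(x j) A)%E].

Definition objective {R : realType} {T : nat} (y : 'rV[R]_T) (delta : R)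
    (ab : 'rV[R]_T * R) : R :=
  \sum_(i < T) ab.1 0 i * y 0 i - ab.2 * delta.

Definition alphas_feasible {R : realType} {n t T : nat}
    (g : 'I_t -> mpol R n) (phi : 'I_T -> mpol R n) (s : nat) :
    set ('rV[R]_T * R) :=
  [set ab | [/\ quad_module s g (1 - lin_comb ab.1 phi),
                quad_module s g (1 + lin_comb ab.1 phi) &
                norm2 ab.1 <= ab.2]].

Definition alphas {R : realType} {n t T : nat} (g : 'I_t -> mpol R n)
    (phi : 'I_T -> mpol R n) (y : 'rV[R]_T) (delta : R) (s : nat) : \bar R :=
  ereal_sup [set (objective y delta ab)%:E | ab in alphas_feasible g phi s].

Definition alpha {R : realType} {n T : nat} (K : set (n.-tuple R))
    (phi : 'I_T -> mpol R n) (y : 'rV[R]_T) (delta : R) : \bar R :=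
  ereal_sup [set (objective y delta ab)%:E | ab in
    [set ab : 'rV[R]_T * R |
       (sup_norm K (lin_comb ab.1 phi) <= 1)%E /\ norm2 ab.1 <= ab.2]].

Definition psd {R : realType} {k : nat} (M : 'M[R]_k) : Prop :=
  M^T = M /\ forall v : 'rV[R]_k, 0 <= (v *m M *m v^T) 0 0.

(* maximise <c, x> over x in R^m subject to
   F0 + x_1 F_1 + ... + x_m F_m positive semidefinite and x A = b. *)
Record sdp (R : realType) := SDP {
  sdp_m : nat;
  sdp_k : nat;
  sdp_q : nat;
  sdp_c : 'rV[R]_sdp_m;
  sdp_F0 : 'M[R]_sdp_k;
  sdp_F : 'I_sdp_m -> 'M[R]_sdp_k;
  sdp_A : 'M[R]_(sdp_m, sdp_q);
  sdp_b : 'rV[R]_sdp_q;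
  sdp_F0_sym : sdp_F0^T = sdp_F0;
  sdp_F_sym : forall i, (sdp_F i)^T = sdp_F i
}.
Arguments sdp_F {R} s i.

Definition sdp_feasible {R : realType} (S : sdp R) : set 'rV[R]_(sdp_m S) :=
  [set x : 'rV[R]_(sdp_m S) | psd (sdp_F0 S + \sum_i x 0 i *: sdp_F S i) /\
           x *m sdp_A S = sdp_b S].

Arguments sdp_feasible {R} S _.

Definition sdp_obj {R : realType} (S : sdp R) (x : 'rV[R]_(sdp_m S)) : R :=
  \sum_i sdp_c S 0 i * x 0 i.

Arguments sdp_obj {R} S x.

Definition sdp_value {R : realType} (S : sdp R) : \bar R :=
  ereal_sup [set (sdp_obj S x)%:E | x in sdp_feasible S].

(* Every real number is the value of some trivial SDP, so "the problem is an
   SDP" has to relate the two problems and not only their values: the SDP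
   lifts the problem of maximising obj over D, i.e. a linear map sends its
   feasible set onto D and carries its objective to obj.  The extra SDP
   variables are, typically, the entries of Gram matrices. *)
Definition sdp_formulation {R : realType} {T : nat} (S : sdp R)
    (D : set ('rV[R]_T * R)) (obj : 'rV[R]_T * R -> R) : Prop :=
  exists (La : 'M[R]_(sdp_m S, T)) (Lb : 'cV[R]_(sdp_m S)),
    let L (x : 'rV[R]_(sdp_m S)) := (x *m La, (x *m Lb) 0 0) in
    [set L x | x in sdp_feasible S] = D /\
    forall x, sdp_feasible S x -> sdp_obj S x = obj (L x).

(* Main.v *)
Require Import Defs.
From HB Require Import structures.
From mathcomp Require Import all_boot all_order all_algebra.
From mathcomp Require Import(canonicals, coercions) mpoly.
From mathcomp Require Import all_classical all_reals all_analysis.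
From mathcomp Require Import measurable_realfun ring lra.

Set Implicit Arguments.
Unset Strict Implicit.
Unset Printing Implicit Defensive.

Import Order.TTheory GRing.Theory Num.Theory.
Import numFieldNormedType.Exports.

Local Open Scope classical_set_scope.
Local Open Scope ring_scope.

(** The upper bound on alpha_s and alpha comes from <a, y> = \int P dmu + <a, eps>
    and Cauchy-Schwarz: every feasible value is at most mu(K).

    Convergence: if |P| <= 1 on K and r < 1, then 1 - rP and 1 + rP are positive
    on K, so by Putinar's Positivstellensatz (r a, r b) is feasible for alpha_s
    when s is large, with r times the objective; let r tend to 1.

    Putinar's theorem is obtained algebraically. By Zorn, a quadratic module M
    without -1 lies in a maximal one Q; if M is archimedean, then
    f |-> sup {r : f - r \in Q} is an algebra homomorphism to R, that is, the
    evaluation at a point of K. Hence if p > 0 on K, M - p * (sums of squares)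
    contains -1, i.e. s p - 1 is in M for a sum of squares s, and Jacobi's
    descent gives p \in M.

    The SDP is the Gram matrix formulation. Positive semidefinite matrices are
    the finite sums of u^T u, so the feasible set is described by finite families
    of vectors u subject to conditions that are linear in the u_i u_j. *)

(** * Archimedean quadratic modules *)

Section QuadraticModules.
Variables (R : realType) (A : comAlgType R).
Implicit Types (Q M : set A) (f h p s : A) (c r k : R).

Definition is_quadmod Q : Prop :=
  [/\ Q 1, forall f g, Q f -> Q g -> Q (f + g) & forall h f, Q f -> Q (h ^+ 2 * f)].

Definition is_sumsq s : Prop := exists l : seq A, s = \sum_(h <- l) h ^+ 2.

(** One-sided, but quantified over every [f]: applied to [- f] it also gives lower bounds. *)
Definition archimedean_qm Q : Prop := forall f, exists k, Q (k%:A - f).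

Lemma qmD Q f h : is_quadmod Q -> Q f -> Q h -> Q (f + h).
Proof. by case=> _ + _; apply. Qed.

Lemma qm_sqrM Q h f : is_quadmod Q -> Q f -> Q (h ^+ 2 * f).
Proof. by case=> _ _; apply. Qed.

Lemma qm_sqr Q h : is_quadmod Q -> Q (h ^+ 2).
Proof. by move=> qQ; rewrite -[_ ^+ 2]mulr1; apply: qm_sqrM => //; case: qQ. Qed.

Lemma qm0 Q : is_quadmod Q -> Q 0.
Proof. by move=> qQ; have := qm_sqr 0 qQ; rewrite expr0n. Qed.

Lemma qmZ Q c f : is_quadmod Q -> 0 <= c -> Q f -> Q (c *: f).
Proof.
move=> qQ c0 Qf; have := qm_sqrM (Num.sqrt c)%:A qQ Qf.
by rewrite exprZn expr1n mulr_algl sqr_sqrtr.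
Qed.

Lemma qm_cst Q c : is_quadmod Q -> 0 <= c -> Q c%:A.
Proof. by move=> qQ c0; apply: qmZ => //; case: qQ. Qed.

(** Allows the certificates below to be written as identities with cleared denominators, which
    [ring] can check. *)
Lemma qm_cancel Q c f : is_quadmod Q -> 0 < c -> Q (c%:A * f) -> Q f.
Proof.
move=> qQ c0 /(qmZ qQ (_ : 0 <= c^-1)); rewrite invr_ge0 => /(_ (ltW c0)).
by rewrite mulr_algl scalerA mulVf ?gt_eqF// scale1r.
Qed.

Lemma qm_sumsqM Q s f : is_quadmod Q -> is_sumsq s -> Q f -> Q (s * f).
Proof.
move=> qQ [l ->] Qf; rewrite mulr_suml; elim: l => [|h l IH].
  by rewrite big_nil; exact: qm0.
by rewrite big_cons; apply: qmD => //; apply: qm_sqrM.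
Qed.

Lemma qm_sumsq Q s : is_quadmod Q -> is_sumsq s -> Q s.
Proof.
by move=> qQ ss; rewrite -[s]mulr1; apply: qm_sumsqM => //; case: qQ.
Qed.

Lemma sumsqD s1 s2 : is_sumsq s1 -> is_sumsq s2 -> is_sumsq (s1 + s2).
Proof. by move=> [l1 ->] [l2 ->]; exists (l1 ++ l2); rewrite big_cat. Qed.

Lemma sumsq_sqrM h s : is_sumsq s -> is_sumsq (h ^+ 2 * s).
Proof.
move=> [l ->]; exists [seq h * u | u <- l].
by rewrite big_map mulr_sumr; apply: eq_bigr => u _; rewrite exprMn.
Qed.

Lemma sumsq_sqr h : is_sumsq (h ^+ 2).
Proof. by exists [:: h]; rewrite big_seq1. Qed.

Lemma sumsq0 : is_sumsq 0.
Proof. by exists [::]; rewrite big_nil. Qed.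

(** Sums of squares are stable under addition and under multiplication by squares. The set is the
    smallest quadratic module containing [M] and [f]. *)
Lemma qm_adjoin M f : is_quadmod M ->
  is_quadmod [set x | exists q s, [/\ M q, is_sumsq s & x = q + f * s]].
Proof.
move=> qM; split.
- exists 1, 0; split; [by case: qM | exact: sumsq0 | by rewrite mulr0 addr0].
- move=> _ _ [q1 [s1 [M1 S1 ->]]] [q2 [s2 [M2 S2 ->]]].
  by exists (q1 + q2), (s1 + s2); split; [exact: qmD | exact: sumsqD | ring].
- move=> h _ [q [s [M1 S1 ->]]].
  by exists (h ^+ 2 * q), (h ^+ 2 * s); split; [exact: qm_sqrM | exact: sumsq_sqrM | ring].
Qed.

Lemma sub_qm_adjoin M f :
  M `<=` [set x | exists q s, [/\ M q, is_sumsq s & x = q + f * s]].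
Proof.
by move=> q Mq; exists q, 0; split => //; [exact: sumsq0 | rewrite mulr0 addr0].
Qed.

Lemma qm_adjoin_gen M f : is_quadmod M ->
  [set x | exists q s, [/\ M q, is_sumsq s & x = q + f * s]] f.
Proof.
move=> qM; exists 0, 1; split; [exact: qm0 | | by rewrite mulr1 add0r].
by rewrite -(expr1n _ 2); exact: sumsq_sqr.
Qed.

(** [Q] need not be closed under products, but (k - f)(k + f) times 2k = (k - f) + (k + f) is a
    combination of k + f and k - f with square coefficients. *)
Lemma qm_cst_subsqr Q k f : is_quadmod Q -> 0 < k ->
  Q (k%:A - f) -> Q (k%:A + f) -> Q ((k ^+ 2)%:A - f ^+ 2).
Proof.
move=> qQ k0 Q1 Q2; apply: (@qm_cancel _ (k *+ 2)) => //; first by rewrite pmulrn_lgt0.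
have -> : (k ^+ 2)%:A = k%:A ^+ 2 :> A by rewrite exprZn expr1n.
have -> : (k *+ 2)%:A * (k%:A ^+ 2 - f ^+ 2) =
    (k%:A - f) ^+ 2 * (k%:A + f) + (k%:A + f) ^+ 2 * (k%:A - f).
  by rewrite -scalerMnl; ring.
by apply: qmD => //; apply: qm_sqrM.
Qed.

Lemma qm_bounded_le Q k1 k2 f : is_quadmod Q -> k1 <= k2 -> Q (k1%:A - f) -> Q (k2%:A - f).
Proof.
move=> qQ k12 Q1; have -> : k2%:A - f = (k2 - k1)%:A + (k1%:A - f).
  by rewrite scalerBl; ring.
by apply: qmD => //; apply: qm_cst; rewrite ?subr_ge0.
Qed.

(** * Maximal proper quadratic modules and their homomorphisms to the reals *)

Section MaximalQuadraticModule.
Variable Q : set A.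
Hypotheses (qQ : is_quadmod Q) (Qproper : ~ Q (- 1)).
Hypothesis Qmax : forall M, is_quadmod M -> Q `<=` M -> ~ M (- 1) -> M `<=` Q.

(** Since 4h = (h + 1)^2 - (h - 1)^2, the support of [Q], its intersection with -Q, is an ideal. *)
Lemma maxqm_supportM f h : Q f -> Q (- f) -> Q (f * h).
Proof.
move=> Qf QNf; apply: (@qm_cancel _ 4) => //.
have -> : 4%:A * (f * h) = (h + 1) ^+ 2 * f + (h - 1) ^+ 2 * (- f).
  by rewrite scaler_nat; ring.
by apply: qmD => //; apply: qm_sqrM.
Qed.

Lemma maxqm_adjoin f : ~ Q f -> exists q s, [/\ Q q, is_sumsq s & - 1 = q + f * s].
Proof.
move=> nQf; apply: contrapT => H; apply: nQf.
exact: (Qmax (qm_adjoin f qQ) (@sub_qm_adjoin Q f) H (qm_adjoin_gen f qQ)).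
Qed.

(** If neither held, maximality would give -1 = q1 + f s1 = q2 - f s2. Eliminating [f] puts -(s1 +
    s2) in [Q], so [s1] lies in the support, which is an ideal, and then -1 = q1 + f s1 is in
    [Q]. *)
Lemma maxqm_total f : Q f \/ Q (- f).
Proof.
apply: contrapT => /not_orP[/maxqm_adjoin[q1 [s1 [Q1 S1 E1]]]].
move=> /maxqm_adjoin[q2 [s2 [Q2 S2 E2]]].
have QNs : Q (- (s1 + s2)).
  have -> : - (s1 + s2) = s2 * q1 + s1 * q2.
    have -> : - (s1 + s2) = s2 * (- 1) + s1 * (- 1) by ring.
    by rewrite {1}E1 E2; ring.
  by apply: qmD => //; apply: qm_sumsqM.
have QNs1 : Q (- s1).
  have -> : - s1 = - (s1 + s2) + s2 by ring.
  by apply: qmD => //; apply: qm_sumsq.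
have Qs1 : Q (- - s1) by rewrite opprK; apply: qm_sumsq.
apply: Qproper; rewrite E1; apply: qmD => //.
have -> : f * s1 = - s1 * - f by ring.
exact: maxqm_supportM.
Qed.

Lemma maxqm_cst c : Q c%:A -> 0 <= c.
Proof.
move=> Qc; rewrite leNgt; apply/negP => c0; apply: Qproper.
apply: (@qm_cancel _ (- c)); rewrite ?oppr_gt0//.
by rewrite mulrN1 scaleNr opprK.
Qed.

Hypothesis Qarch : archimedean_qm Q.

(** The Dedekind cut of [f]: by totality of [Q], constants below the value are lower bounds of [f]
    modulo [Q] and constants above it are upper bounds. *)
Definition maxqm_eval f : R := sup [set r | Q (f - r%:A)].

Lemma maxqm_has_sup f : has_sup [set r | Q (f - r%:A)].
Proof.
split.
  have [k Hk] := Qarch (- f); exists (- k) => /=.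
  by move: Hk; rewrite scaleNr !opprK addrC.
have [k Hk] := Qarch f; exists k => r /= Qr.
rewrite -subr_ge0; apply: maxqm_cst; rewrite scalerBl.
by have := qmD qQ Hk Qr; rewrite addrA subrK.
Qed.

Lemma maxqm_eval_ge f r : Q (f - r%:A) -> r <= maxqm_eval f.
Proof. by move=> Qr; apply: sup_upper_bound => //; exact: maxqm_has_sup. Qed.

Lemma maxqm_eval_le f r : Q (r%:A - f) -> maxqm_eval f <= r.
Proof.
move=> Qr; apply: ge_sup; first by have [] := maxqm_has_sup f.
move=> u /= Qu; rewrite -subr_ge0; apply: maxqm_cst; rewrite scalerBl.
by have := qmD qQ Qr Qu; rewrite addrA subrK.
Qed.

Lemma maxqm_lt_eval f r : r < maxqm_eval f -> Q (f - r%:A).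
Proof.
move=> lt_r; have [//|] := maxqm_total (f - r%:A).
by rewrite opprB => /maxqm_eval_le; rewrite leNgt lt_r.
Qed.

Lemma maxqm_gt_eval f r : maxqm_eval f < r -> Q (r%:A - f).
Proof.
move=> lt_r; have [//|] := maxqm_total (r%:A - f).
by rewrite opprB => /maxqm_eval_ge; rewrite leNgt lt_r.
Qed.

Lemma maxqm_eval_ge0 f : Q f -> 0 <= maxqm_eval f.
Proof. by move=> Qf; apply: maxqm_eval_ge; rewrite scale0r subr0. Qed.

Lemma maxqm_evalC c : maxqm_eval c%:A = c.
Proof.
apply/eqP; rewrite eq_le; apply/andP; split.
  by apply: maxqm_eval_le; rewrite subrr; exact: qm0.
by apply: maxqm_eval_ge; rewrite subrr; exact: qm0.
Qed.

Lemma maxqm_evalN f : maxqm_eval (- f) = - maxqm_eval f.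
Proof.
apply/eqP; rewrite eq_le; apply/andP; split; apply/ler_addgt0Pr => e e0.
  apply: maxqm_eval_le; rewrite scalerDl scaleNr opprK.
  have := @maxqm_lt_eval f (maxqm_eval f - e).
  by rewrite gtrBl e0 scalerBl => /(_ isT); congr Q; ring.
rewrite -lerBlDr; apply: maxqm_eval_ge.
have := @maxqm_gt_eval f (maxqm_eval f + e).
by rewrite ltrDl e0 scalerBl scaleNr scalerDl => /(_ isT); congr Q; ring.
Qed.

(** Subadditivity suffices: applied to f + h and -h, together with [maxqm_evalN], it gives the other
    inequality. *)
Lemma maxqm_evalD f h : maxqm_eval (f + h) = maxqm_eval f + maxqm_eval h.
Proof.
have sub u v : maxqm_eval (u + v) <= maxqm_eval u + maxqm_eval v.
  apply/ler_addgt0Pr => e e0; apply: maxqm_eval_le.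
  have e2 : 0 < e / 2 by rewrite divr_gt0.
  have Hu := @maxqm_gt_eval u (maxqm_eval u + e / 2).
  have Hv := @maxqm_gt_eval v (maxqm_eval v + e / 2).
  have := qmD qQ (Hu _) (Hv _); rewrite !ltrDl e2 => /(_ isT isT).
  rewrite addrACA -opprD -scalerDl.
  by have -> : maxqm_eval u + e / 2 + (maxqm_eval v + e / 2)
    = maxqm_eval u + maxqm_eval v + e by field.
apply/eqP; rewrite eq_le sub /= -lerBrDr -maxqm_evalN.
by apply: le_trans (sub _ _); rewrite addrK.
Qed.

(** At value zero homogeneity is a mere estimate: for c >= 0, [f] between -e and e modulo [Q] puts c
    f between -c e and c e. The general case then subtracts the constant [maxqm_eval f]. *)
Lemma maxqm_evalZ0 c f : maxqm_eval f = 0 -> maxqm_eval (c *: f) = 0.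
Proof.
wlog c0 : c / 0 <= c => [H f0|].
  have [c0|/ltW c0] := leP 0 c; first exact: H.
  by apply/eqP; rewrite -oppr_eq0 -maxqm_evalN -scaleNr H// oppr_ge0.
move=> f0; have ub e : 0 < e -> `|maxqm_eval (c *: f)| <= c * e.
  move=> e0; rewrite ler_norml; apply/andP; split.
    apply: maxqm_eval_ge; have := @maxqm_lt_eval f (- e).
    rewrite f0 oppr_lt0 e0 => /(_ isT) /(qmZ qQ c0).
    by rewrite scalerBr scalerA mulrN.
  apply: maxqm_eval_le; have := @maxqm_gt_eval f e.
  rewrite f0 e0 => /(_ isT) /(qmZ qQ c0).
  by rewrite scalerBr scalerA.
move: c0; rewrite le_eqVlt => /predU1P[<-|c0].
  by rewrite scale0r -(scale0r 1) maxqm_evalC.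
apply/eqP; rewrite -normr_le0; apply/ler_addgt0Pr => e e0; rewrite add0r.
by apply: le_trans (ub (e / c) _) _; rewrite ?divr_gt0// mulrC divfK ?gt_eqF.
Qed.

Lemma maxqm_evalZ c f : maxqm_eval (c *: f) = c * maxqm_eval f.
Proof.
pose u := maxqm_eval f.
have -> : c *: f = c *: (f - u%:A) + (c * u)%:A.
  by rewrite scalerBr scalerA subrK.
rewrite maxqm_evalD maxqm_evalC maxqm_evalZ0 ?add0r//.
by rewrite maxqm_evalD maxqm_evalN maxqm_evalC subrr.
Qed.

(** An [h] of value zero lies between plus and minus the root of e, so e - h^2 is in [Q] for every e
    > 0. A general [f] is shifted by its value [u] and the square is expanded. *)
Lemma maxqm_eval_sqr f : maxqm_eval (f ^+ 2) = maxqm_eval f ^+ 2.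
Proof.
have H h : maxqm_eval h = 0 -> maxqm_eval (h ^+ 2) = 0.
  move=> h0; apply/eqP; rewrite eq_le maxqm_eval_ge0 ?andbT; last exact: qm_sqr.
  apply/ler_addgt0Pr => e e0; rewrite add0r -(sqr_sqrtr (ltW e0)).
  apply: maxqm_eval_le; apply: qm_cst_subsqr => //; rewrite ?sqrtr_gt0//.
    by apply: maxqm_gt_eval; rewrite h0 sqrtr_gt0.
  rewrite addrC -[_%:A]opprK -scaleNr; apply: maxqm_lt_eval.
  by rewrite h0 oppr_lt0 sqrtr_gt0.
pose u := maxqm_eval f.
have := H (f - u%:A); rewrite maxqm_evalD maxqm_evalN maxqm_evalC subrr => /(_ erefl).
have -> : (f - u%:A) ^+ 2 = f ^+ 2 + ((- u *+ 2) *: f + (u ^+ 2)%:A).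
  rewrite -[(- u *+ 2) *: f]mulr_algl -scalerMnl scaleNr.
  have -> : (u ^+ 2)%:A = u%:A ^+ 2 :> A by rewrite exprZn expr1n.
  by ring.
rewrite !maxqm_evalD maxqm_evalZ maxqm_evalC -/u => /eqP.
rewrite addr_eq0 => /eqP ->; ring.
Qed.

(** Polarization reduces products to squares. *)
Lemma maxqm_evalM f h : maxqm_eval (f * h) = maxqm_eval f * maxqm_eval h.
Proof.
have : maxqm_eval ((f + h) ^+ 2) = (maxqm_eval f + maxqm_eval h) ^+ 2.
  by rewrite maxqm_eval_sqr maxqm_evalD.
have -> : (f + h) ^+ 2 = f ^+ 2 + (2 *: (f * h) + h ^+ 2).
  by rewrite scaler_nat; ring.
rewrite !maxqm_evalD maxqm_evalZ !maxqm_eval_sqr => H.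
lra.
Qed.

End MaximalQuadraticModule.

Lemma maxqm_exists M : is_quadmod M -> ~ M (- 1) ->
  exists Q, [/\ is_quadmod Q, M `<=` Q, ~ Q (- 1) &
    forall Q', is_quadmod Q' -> Q `<=` Q' -> ~ Q' (- 1) -> Q' `<=` Q].
Proof.
move=> qM Mproper.
pose P : set (set A) := [set Q | Q = set0 \/ [/\ is_quadmod Q, M `<=` Q & ~ Q (- 1)]].
have [F FP Ftot|Q [PQ Qmax]] := @Zorn_bigcup _ P.
  have [F0|] := pselect (forall X, F X -> X = set0).
    by left; rewrite -subset0 => x [X /F0 ->].
  move=> /existsNP[X0 /not_implyP[FX0 X0n]].
  have mem X : F X -> X !=set0 -> [/\ is_quadmod X, M `<=` X & ~ X (- 1)].
    by move=> /FP [->|//] [].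
  have [qX0 MX0 _] : [/\ is_quadmod X0, M `<=` X0 & ~ X0 (- 1)].
    by apply: mem => //; apply/set0P/eqP.
  right; split.
  - split.
    + by exists X0 => //; case: qX0.
    + move=> f h [X FX Xf] [Y FY Yh].
      have [qX _ _] := mem _ FX (ex_intro _ _ Xf).
      have [qY _ _] := mem _ FY (ex_intro _ _ Yh).
      have [XY|YX] := Ftot _ _ FX FY.
        by exists Y => //; apply: qmD => //; exact: XY.
      by exists X => //; apply: qmD => //; exact: YX.
    + move=> h f [X FX Xf]; have [qX _ _] := mem _ FX (ex_intro _ _ Xf).
      by exists X => //; exact: qm_sqrM.
  - by move=> x /MX0 ?; exists X0.
  - by move=> [X FX XN1]; have [_ _] := mem _ FX (ex_intro _ _ XN1); apply.
have [Q0|[qQ MQ QN1]] := PQ.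
  exfalso; apply: (Qmax M); last by right; split.
  rewrite Q0; split; first exact: sub0set.
  by move=> /(_ 1); case: qM => M1 _ _ /(_ M1).
exists Q; split=> // Q' qQ' QQ' Q'N1; apply: contrapT => H.
apply: (Qmax Q'); first by split.
by right; split=> //; exact: subset_trans QQ'.
Qed.

(* The step of Jacobi's descent: if s * p - 1 is in M, then p + r can be lowered
   by the fixed amount 1 / k ^ 2. *)
Lemma qm_descent_step M p s k r : is_quadmod M -> is_sumsq s -> 0 < k -> 0 <= r ->
  M (s * p - 1) -> M ((2 * k)%:A - s) -> M ((2 * k - 1)%:A - s ^+ 2 * p) ->
  M (p + r%:A) -> M (p + (r - k ^- 2)%:A).
Proof.
move=> qM ss k0 r0 Msp Ms Ms2p Mpr.
(* The device of [qm_cst_subsqr] again, with 2k = (2k - s) + s; here [s] is itself a sum of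
   squares. *)
have Mss : M (s * ((2 * k)%:A - s)).
  apply: (@qm_cancel _ (2 * k)) => //; first by rewrite mulr_gt0.
  have -> : (2 * k)%:A * (s * ((2 * k)%:A - s)) =
      s * (((2 * k)%:A - s) ^+ 2 * 1) + s ^+ 2 * ((2 * k)%:A - s) by ring.
  apply: qmD => //; last exact: qm_sqrM.
  by apply: qm_sumsqM => //; apply: qm_sqrM => //; case: qM.
have k2 : 0 < k ^+ 2 by rewrite exprn_gt0.
apply: (qm_cancel qM k2).
(* Replacing k^2 by (k - s)^2 in k^2 (p + r) loses r s (2k - s) and (2ks - s^2) p. The latter is 2k
   (s p - 1) + (2k - 1 - s^2 p) + 1, and the final 1 is the gain k^2 k^-2. *)
have -> : (k ^+ 2)%:A * (p + (r - k ^- 2)%:A) =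
   (k%:A - s) ^+ 2 * (p + r%:A) + (2 * k) *: (s * p - 1)
   + (r *: (s * ((2 * k)%:A - s)) + ((2 * k - 1)%:A - s ^+ 2 * p)).
  rewrite -[(2 * k) *: (_ - _)]mulr_algl -[r *: (s * _)]mulr_algl.
  have E : (k ^+ 2)%:A * (k ^- 2)%:A = 1 :> A.
    by rewrite mulr_algl scalerA divff ?gt_eqF// scale1r.
  rewrite scalerBl mulrDr mulrBr E.
  have -> : (k ^+ 2)%:A = k%:A ^+ 2 :> A by rewrite exprZn expr1n.
  have -> : (2 * k)%:A = 2 * k%:A :> A by rewrite -scalerA scaler_nat mulr_natl.
  have -> : (2 * k - 1)%:A = 2 * k%:A - 1 :> A.
    by rewrite scalerBl scale1r -scalerA scaler_nat mulr_natl.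
  by ring.
apply: qmD => //; apply: qmD => //.
- exact: qm_sqrM.
- by apply: qmZ => //; rewrite mulr_ge0// ltW.
- exact: qmZ.
Qed.

(** Some p + r0 is in [M], and every descent step lowers the constant by the same amount, so
    finitely many steps make it nonpositive. *)
Lemma qm_descent M p s : is_quadmod M -> archimedean_qm M -> is_sumsq s ->
  M (s * p - 1) -> M p.
Proof.
move=> qM aM ss Msp.
have [k1 H1] := aM s; have [k2 H2] := aM (s ^+ 2 * p); have [r0 H0] := aM (- p).
(* Large enough that 2k dominates [k1] and 2k - 1 dominates [k2]. *)
pose k := `|k1| + `|k2| + 1.
have k0 : 0 < k by rewrite ltr_wpDl// addr_ge0.
have Hk1 : M ((2 * k)%:A - s).
  apply: qm_bounded_le H1 => //; rewrite /k; have := ler_norm k1.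
  have := normr_ge0 k1; have := normr_ge0 k2; lra.
have Hk2 : M ((2 * k - 1)%:A - s ^+ 2 * p).
  apply: qm_bounded_le H2 => //; rewrite /k; have := ler_norm k2.
  have := normr_ge0 k1; have := normr_ge0 k2; lra.
pose d := k ^- 2; have d0 : 0 < d by rewrite invr_gt0 exprn_gt0.
(* The first alternative absorbs the case of a negative constant, where [p] is already in [M] and
   the descent step, which requires 0 <= r, does not apply. *)
suff D m : M p \/ M (p + (r0 - m%:R * d)%:A).
  have [m Hm] : exists m : nat, r0 <= m%:R * d.
    exists (Num.bound `|r0 / d|); rewrite -ler_pdivrMr//.
    exact: ltW (le_lt_trans (ler_norm _) (archi_boundP (normr_ge0 _))).
  have [//|Mp] := D m.
  have -> : p = (p + (r0 - m%:R * d)%:A) + (m%:R * d - r0)%:A.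
    by rewrite !scalerBl; ring.
  by apply: qmD => //; apply: qm_cst => //; rewrite subr_ge0.
elim: m => [|m [|IH]]; [right | by left |].
  by rewrite mul0r subr0 addrC; move: H0; rewrite opprK.
have [neg|pos] := ltP (r0 - m%:R * d) 0.
  left; have -> : p = (p + (r0 - m%:R * d)%:A) + (- (r0 - m%:R * d))%:A.
    by rewrite scaleNr; ring.
  by apply: qmD => //; apply: qm_cst => //; rewrite oppr_ge0 ltW.
right; have := qm_descent_step qM ss k0 pos Msp Hk1 Hk2 IH.
by rewrite -/d -addrA -opprD -natr1 mulrDl mul1r.
Qed.

(* Jacobi's representation theorem. If p is not in M, the descent shows that -1
   is not in M - p * (sums of squares), and a maximal proper extension of the
   latter yields a homomorphism phi that is nonnegative on M with phi p <= 0. *)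
Lemma archimedean_qm_repr M p : is_quadmod M -> archimedean_qm M ->
  (forall phi : A -> R, (forall f h, phi (f + h) = phi f + phi h) ->
     (forall f h, phi (f * h) = phi f * phi h) -> (forall c, phi c%:A = c) ->
     (forall f, M f -> 0 <= phi f) -> 0 < phi p) ->
  M p.
Proof.
move=> qM aM pos; apply: contrapT => nMp.
pose M' := [set x | exists q s, [/\ M q, is_sumsq s & x = q + (- p) * s]].
have qM' : is_quadmod M' by exact: qm_adjoin.
have M'N1 : ~ M' (- 1).
  move=> [q [s [Mq ss E]]]; apply: nMp; apply: (qm_descent qM aM ss).
  by have -> : s * p - 1 = q by rewrite E; ring.
have [Q [qQ M'Q QN1 Qmax]] := maxqm_exists qM' M'N1.
have MQ : M `<=` Q by apply: subset_trans M'Q; exact: sub_qm_adjoin.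
have aQ : archimedean_qm Q by move=> f; have [k Hk] := aM f; exists k; exact: MQ.
have := pos (maxqm_eval Q) (maxqm_evalD qQ QN1 Qmax aQ)
  (maxqm_evalM qQ QN1 Qmax aQ) (maxqm_evalC qQ QN1 aQ).
have QNp : Q (- p) by apply: M'Q; exact: qm_adjoin_gen.
have := maxqm_eval_ge0 qQ QN1 aQ QNp; rewrite (maxqm_evalN qQ QN1 Qmax aQ) oppr_ge0.
move=> le0 /(_ (fun f Mf => maxqm_eval_ge0 qQ QN1 aQ (MQ _ Mf))).
by rewrite ltNge le0.
Qed.

(** * The bounded elements form a subalgebra *)

Section BoundedElements.
Variable M : set A.
Hypothesis qM : is_quadmod M.

Definition qm_bounded f : Prop := exists2 k, 0 < k & M (k%:A - f) /\ M (k%:A + f).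

(** Allows two different constants, of any sign. *)
Lemma qm_boundedP f : qm_bounded f <-> exists k1 k2, M (k1%:A - f) /\ M (k2%:A + f).
Proof.
split=> [[k _ [H1 H2]]|[k1 [k2 [H1 H2]]]]; first by exists k, k.
exists (`|k1| + `|k2| + 1); first by rewrite ltr_wpDl// addr_ge0.
split.
  apply: (qm_bounded_le qM) H1; have := ler_norm k1.
  have := normr_ge0 k1; have := normr_ge0 k2; lra.
rewrite -[f]opprK; apply: (qm_bounded_le qM (k1 := k2)); last by rewrite opprK.
by have := ler_norm k2; have := normr_ge0 k1; have := normr_ge0 k2; lra.
Qed.

Lemma qm_boundedC c : qm_bounded c%:A.
Proof.
apply/qm_boundedP; exists c, (- c); rewrite subrr scaleNr addNr.
by split; exact: qm0.
Qed.

Lemma qm_boundedN f : qm_bounded f -> qm_bounded (- f).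
Proof. by move=> [k k0 [H1 H2]]; exists k => //; rewrite opprK. Qed.

Lemma qm_boundedD f h : qm_bounded f -> qm_bounded h -> qm_bounded (f + h).
Proof.
move=> [k1 k10 [F1 F2]] [k2 k20 [H1 H2]]; exists (k1 + k2); first exact: addr_gt0.
rewrite scalerDl; split.
  by have := qmD qM F1 H1; congr M; ring.
by have := qmD qM F2 H2; congr M; ring.
Qed.

Lemma qm_bounded_sqr f : qm_bounded f -> qm_bounded (f ^+ 2).
Proof.
move=> [k k0 [H1 H2]]; apply/qm_boundedP; exists (k ^+ 2), 0; split.
  exact: qm_cst_subsqr.
by rewrite scale0r add0r; exact: qm_sqr.
Qed.

Lemma qm_boundedZ c f : qm_bounded f -> qm_bounded (c *: f).
Proof.
wlog c0 : c / 0 <= c => [H bf|].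
  have [c0|/ltW c0] := leP 0 c; first exact: H.
  by rewrite -[c *: f]opprK -scaleNr; apply/qm_boundedN/H; rewrite ?oppr_ge0.
move=> [k k0 [H1 H2]]; apply/qm_boundedP; exists (c * k), (c * k).
rewrite -scalerA -scalerBr -scalerDr.
by split; apply: qmZ.
Qed.

(** Polarization: 2fh = (f + h)^2 - f^2 - h^2, and squares and linear combinations of bounded
    elements are bounded. *)
Lemma qm_boundedM f h : qm_bounded f -> qm_bounded h -> qm_bounded (f * h).
Proof.
move=> bf bh.
have -> : f * h = 2^-1 *: ((f + h) ^+ 2 - f ^+ 2 - h ^+ 2).
  have -> : (f + h) ^+ 2 - f ^+ 2 - h ^+ 2 = 2 *: (f * h).
    by rewrite scaler_nat; ring.
  by rewrite scalerA mulVf// scale1r.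
apply: qm_boundedZ; apply: qm_boundedD; last exact/qm_boundedN/qm_bounded_sqr.
apply: qm_boundedD; last exact/qm_boundedN/qm_bounded_sqr.
exact/qm_bounded_sqr/qm_boundedD.
Qed.

(** Completing the square: k + 1/4 - f = (k - f^2) + (f - 1/2)^2, and likewise with + f. *)
Lemma qm_bounded_of_sqr f k : M (k%:A - f ^+ 2) -> qm_bounded f.
Proof.
move=> Mf; apply/qm_boundedP; exists (k + 4^-1), (k + 4^-1).
have E : (4^-1)%:A = (2^-1)%:A ^+ 2 :> A.
  by rewrite exprZn expr1n; congr (_ *: _); field.
have F : 2 * (2^-1)%:A * f = f.
  by rewrite mulr_natl -scaler_nat scalerA mulfV// scale1r mul1r.
rewrite scalerDl E; split.
  have := qmD qM Mf (qm_sqr (f - (2^-1)%:A) qM); congr M.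
  by rewrite -[X in _ = _ - X]F; ring.
have := qmD qM Mf (qm_sqr (f + (2^-1)%:A) qM); congr M.
by rewrite -[X in _ = _ + X]F; ring.
Qed.

End BoundedElements.
End QuadraticModules.

(** * Putinar's Positivstellensatz *)

Section Putinar.
Variables (R : realType) (n t : nat).
Implicit Types (p q h : mpol R n) (g : 'I_t -> mpol R n) (e : nat).

Lemma sos_le e1 e2 p : (e1 <= e2)%N -> sos e1 p -> sos e2 p.
Proof.
move=> e12 [l /allP ls ->]; exists l => //; apply/allP => h /ls /leq_trans; exact.
Qed.

Lemma sosD e p q : sos e p -> sos e q -> sos e (p + q).
Proof.
by move=> [l1 s1 ->] [l2 s2 ->]; exists (l1 ++ l2); rewrite ?all_cat ?s1// big_cat.
Qed.

Lemma sos0 e : sos e (0 : mpol R n).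
Proof. by exists [::]; rewrite ?big_nil. Qed.

Lemma sos1 e : sos e (1 : mpol R n).
Proof. by exists [:: 1]; rewrite /= ?mpoly.msize1// big_seq1 expr1n. Qed.

Lemma sos_sqrM e h p : sos e p -> sos (mpoly.msize h + e).+1 (h ^+ 2 * p).
Proof.
move=> [l /allP ls ->]; exists [seq h * u | u <- l]; last first.
  by rewrite big_map mulr_sumr; apply: eq_bigr => u _; rewrite exprMn.
apply/allP => _ /mapP[u /ls su ->]; apply: leq_trans (mpoly.msizeM_le _ _) _.
by rewrite ltnS -addnS leq_add2l.
Qed.

Lemma quad_module_le g e1 e2 : (e1 <= e2)%N -> quad_module e1 g `<=` quad_module e2 g.
Proof.
move=> e12 f [s0 [s [S0 S ->]]]; exists s0, s; split => //.
  exact: sos_le S0.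
by move=> i; exact: sos_le (S i).
Qed.

Lemma quad_moduleD g e p q :
  quad_module e g p -> quad_module e g q -> quad_module e g (p + q).
Proof.
move=> [s0 [s [S0 S ->]]] [u0 [u [U0 U ->]]].
exists (s0 + u0), (fun i => s i + u i); split=> [|i|]; try exact: sosD.
rewrite addrACA -big_split; congr (_ + _).
by apply: eq_bigr => i _; rewrite mulrDr.
Qed.

Lemma quad_module_sqrM g e h p :
  quad_module e g p -> quad_module (mpoly.msize h + e).+1 g (h ^+ 2 * p).
Proof.
move=> [s0 [s [S0 S ->]]]; exists (h ^+ 2 * s0), (fun i => h ^+ 2 * s i).
split=> [|i|]; try exact: sos_sqrM.
by rewrite mulrDr mulr_sumr; congr (_ + _); apply: eq_bigr => i _; rewrite mulrCA.
Qed.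

Lemma quad_module_sos g e p : sos e p -> quad_module e g p.
Proof.
move=> sp; exists p, (fun=> 0); split=> // [i|]; first exact: sos0.
by rewrite big1 ?addr0// => i _; rewrite mulr0.
Qed.

Lemma quad_module1 g e : quad_module e g 1.
Proof. exact/quad_module_sos/sos1. Qed.

Lemma quad_module_gen g e i : quad_module e g (g i).
Proof.
exists 0, (fun j => (j == i)%:R); split=> [|j|]; first exact: sos0.
  by case: eqP => _; [exact: sos1 | exact: sos0].
rewrite (bigD1 i)//= eqxx mulr1 big1 ?addr0 ?add0r// => j /negPf ->.
by rewrite mulr0.
Qed.

(** The union over all degrees is taken because multiplication by a square raises the degree
    bound. *)
Lemma quad_module_is_quadmod g : is_quadmod [set f | exists e, quad_module e g f].
Proof.
split=> [|f q [e1 H1] [e2 H2]|h f [e H]].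
- by exists 0%N; exact: quad_module1.
- by exists (maxn e1 e2); apply: quad_moduleD;
    [apply: quad_module_le H1; exact: leq_maxl
    | apply: quad_module_le H2; exact: leq_maxr].
- by exists (mpoly.msize h + e).+1; exact: quad_module_sqrM.
Qed.

Lemma peval_sos_ge0 e p x : sos e p -> 0 <= peval p x.
Proof.
move=> [l _ ->]; rewrite /peval rmorph_sum sumr_ge0// => h _.
by rewrite rmorphXn sqr_ge0.
Qed.

Lemma peval_quad_module_ge0 g e p (x : n.-tuple R) :
  (forall i, 0 <= peval (g i) x) -> quad_module e g p -> 0 <= peval p x.
Proof.
move=> gx [s0 [s [S0 S ->]]]; rewrite /peval mpoly.mevalD addr_ge0//.
  exact: peval_sos_ge0 S0.
rewrite rmorph_sum sumr_ge0// => i _; rewrite /= mpoly.mevalM mulr_ge0//.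
  exact: gx.
exact: peval_sos_ge0 (S i).
Qed.

(** Constants and variables generate the polynomial algebra. This induction serves for boundedness,
    for homomorphisms and for measurability. *)
Lemma mpoly_gen_ind (P : mpol R n -> Prop) :
  (forall c, P c%:A) -> (forall i, P (pvar R i)) ->
  (forall p q, P p -> P q -> P (p + q)) -> (forall p q, P p -> P q -> P (p * q)) ->
  forall p, P p.
Proof.
move=> PC PX PD PM; have P1 : P 1 by rewrite -[1]scale1r.
elim/mpoly.mpolyind => [|c m p _ _ Pp]; first by rewrite -[0](scale0r 1).
apply: (PD _ _ _ Pp); rewrite -mulr_algl; apply: (PM _ _ (PC c)).
rewrite mpoly.mpolyXE_id; elim/big_rec: _ => // i q _ Pq; apply: (PM _ _ _ Pq).
by elim: (m i) => [|k IH]; rewrite ?expr0// exprS; apply: PM => //; exact: PX.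
Qed.

(** Adding the squares of the other variables to N - |x|^2 gives N - x_i^2, so each variable is
    bounded, and bounded elements form a subalgebra. *)
Lemma quad_module_archimedean g e N :
  quad_module e g (N%:R - sqnorm_poly R n) ->
  archimedean_qm [set f | exists e, quad_module e g f].
Proof.
move=> HN; set M := [set f | _]; have qM : is_quadmod M by exact: quad_module_is_quadmod.
suff B p : qm_bounded M p by move=> p; have [k _ [Hk _]] := B p; exists k.
elim/mpoly_gen_ind: p => [c|i|p q|p q];
  [exact: qm_boundedC | | exact: qm_boundedD | exact: qm_boundedM].
apply: (qm_bounded_of_sqr qM (k := N%:R)).
have -> : N%:R%:A - pvar R i ^+ 2 =
    (N%:R - sqnorm_poly R n) + \sum_(j < n | j != i) pvar R j ^+ 2.
  by rewrite scaler_nat /sqnorm_poly (bigD1 i)//= opprD addrA subrK.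
apply: (qmD qM); first by exists e.
elim/big_rec: _ => [|j q _ Mq]; first exact: qm0.
by apply: (qmD qM) => //; exact: (qm_sqr _ qM).
Qed.

Lemma alg_hom_peval (phi : mpol R n -> R) :
  (forall f h, phi (f + h) = phi f + phi h) ->
  (forall f h, phi (f * h) = phi f * phi h) -> (forall c, phi c%:A = c) ->
  forall p, phi p = peval p [tuple phi (pvar R i) | i < n].
Proof.
move=> phiD phiM phiC; elim/mpoly_gen_ind => [c|i|p q Hp Hq|p q Hp Hq].
- by rewrite phiC /peval mpoly.mevalZ mpoly.meval1 mulr1.
- by rewrite /peval /pvar mpoly.mevalXU tnth_mktuple.
- by rewrite phiD Hp Hq /peval mpoly.mevalD.
- by rewrite phiM Hp Hq /peval mpoly.mevalM.
Qed.

(** The homomorphisms of the representation theorem are evaluations at points. Nonnegativity on the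
    module, which contains each [g i], places these points where all [g i] are nonnegative, and
    there [p] is positive. *)
Lemma putinar_positivstellensatz g e N p :
  quad_module e g (N%:R - sqnorm_poly R n) ->
  (forall x, (forall i, 0 <= peval (g i) x) -> 0 < peval p x) ->
  exists s, quad_module s g p.
Proof.
move=> /quad_module_archimedean arch pos.
apply: (archimedean_qm_repr (quad_module_is_quadmod g) arch) => phi phiD phiM phiC phi0.
rewrite (alg_hom_peval phiD phiM phiC); apply: pos => i.
rewrite -(alg_hom_peval phiD phiM phiC); apply: phi0.
by exists 0%N; exact: quad_module_gen.
Qed.

End Putinar.

(** * Bounds and convergence *)

Section EuclideanNorm.
Variables (R : realType) (T : nat).
Implicit Types (a e : 'rV[R]_T).

Lemma norm2_ge0 a : 0 <= norm2 a.
Proof. exact: sqrtr_ge0. Qed.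

Lemma sqr_norm2 a : norm2 a ^+ 2 = \sum_i a 0 i ^+ 2.
Proof. by rewrite sqr_sqrtr// sumr_ge0// => i _; rewrite sqr_ge0. Qed.

Lemma norm2_eq0 a : norm2 a = 0 -> a = 0.
Proof.
move=> a0; apply/rowP => i; rewrite mxE; apply/eqP; rewrite -sqrf_eq0.
have /eqP := sqr_norm2 a; rewrite a0 expr0n eq_sym psumr_eq0 => [/allP/(_ i)|j _].
  by rewrite mem_index_enum => /(_ isT).
exact: sqr_ge0.
Qed.

Lemma norm2Z c a : norm2 (c *: a) = `|c| * norm2 a.
Proof.
rewrite -sqrtr_sqr -sqrtrM ?sqr_ge0//.
rewrite mulr_sumr; congr Num.sqrt.
by apply: eq_bigr => i _; rewrite mxE exprMn.
Qed.

(** The vector |e|^2 a - <a, e> e is a multiple of the component of [a] orthogonal to [e]; its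
    squared norm is |e|^2 (|a|^2 |e|^2 - <a, e>^2). *)
Lemma cauchy_schwarz a e : \sum_i a 0 i * e 0 i <= norm2 a * norm2 e.
Proof.
have [/norm2_eq0 ->|e0] := eqVneq (norm2 e) 0.
  by rewrite big1 ?mulr_ge0 ?norm2_ge0// => i _; rewrite mxE mulr0.
have {}e0 : 0 < norm2 e by rewrite lt_def e0 norm2_ge0.
move CE: (\sum_i a 0 i * e 0 i) => C.
have : 0 <= \sum_i (norm2 e ^+ 2 * a 0 i - C * e 0 i) ^+ 2.
  by rewrite sumr_ge0// => i _; rewrite sqr_ge0.
have -> : \sum_i (norm2 e ^+ 2 * a 0 i - C * e 0 i) ^+ 2 =
   norm2 e ^+ 4 * (\sum_i a 0 i ^+ 2) - 2 * norm2 e ^+ 2 * C * C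
   + C ^+ 2 * \sum_i e 0 i ^+ 2.
  have -> : 2 * norm2 e ^+ 2 * C * C = \sum_i 2 * norm2 e ^+ 2 * C * (a 0 i * e 0 i).
    by rewrite -mulr_sumr CE.
  by rewrite !mulr_sumr -sumrB -big_split; apply: eq_bigr => i _ /=; ring.
rewrite -!sqr_norm2.
have -> : norm2 e ^+ 4 * norm2 a ^+ 2 - 2 * norm2 e ^+ 2 * C * C + C ^+ 2 * norm2 e ^+ 2
  = norm2 e ^+ 2 * ((norm2 a * norm2 e) ^+ 2 - C ^+ 2) by ring.
rewrite pmulr_rge0 ?exprn_gt0// subr_ge0 => H.
apply: le_trans (ler_norm _) _.
by rewrite -(@ler_pXn2r _ 2) ?nnegrE ?mulr_ge0 ?norm2_ge0// real_normK ?num_real.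
Qed.

End EuclideanNorm.

(** * Feasible points and their shrinking *)

Section Feasibility.
Variables (R : realType) (n t T : nat).
Implicit Types (p : mpol R n) (phi : 'I_T -> mpol R n) (a y : 'rV[R]_T).
Implicit Types (g : 'I_t -> mpol R n) (K : set (n.-tuple R)).

Definition basic_semialgebraic g : set (n.-tuple R) :=
  [set x | forall i, 0 <= peval (g i) x].

Lemma lin_combZ c a phi : lin_comb (c *: a) phi = c *: lin_comb a phi.
Proof. by rewrite scaler_sumr; apply: eq_bigr => i _; rewrite mxE scalerA. Qed.

Lemma lin_comb0 phi : lin_comb 0 phi = 0.
Proof. by rewrite /lin_comb big1// => i _; rewrite mxE scale0r. Qed.

(** Covers empty [K] as well, where the extended-real supremum is -oo. *)
Lemma sup_norm_le1P K p :
  (sup_norm K p <= 1)%E <-> forall x, K x -> `|peval p x| <= 1.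
Proof.
split=> [H x Kx|H].
  rewrite -lee_fin; apply: le_trans H; apply: ereal_sup_ubound.
  by exists x.
by apply: ge_ereal_sup => _ [x Kx <-]; rewrite lee_fin H.
Qed.

Lemma objectiveZ y delta c a b :
  objective y delta (c *: a, c * b) = c * objective y delta (a, b).
Proof.
rewrite /objective /= mulrBr mulr_sumr mulrA; congr (_ - _).
by apply: eq_bigr => i _; rewrite mxE mulrA.
Qed.

Lemma alphas_feasible0 g phi s : alphas_feasible g phi s (0, 0).
Proof.
split=> /=; rewrite ?lin_comb0 ?subr0 ?addr0; try exact: quad_module1.
by rewrite -(scale0r 0) norm2Z normr0 mul0r.
Qed.

Lemma alphas_feasible_le g phi s1 s2 : (s1 <= s2)%N ->
  alphas_feasible g phi s1 `<=` alphas_feasible g phi s2.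
Proof. by move=> s12 ab [H1 H2 H3]; split=> //; exact: quad_module_le s12 _ _. Qed.

Lemma alphas_feasible_sup_norm g phi s a b :
  alphas_feasible g phi s (a, b) ->
  (sup_norm (basic_semialgebraic g) (lin_comb a phi) <= 1)%E.
Proof.
case=> /= H1 H2 _; apply/sup_norm_le1P => x /= Kx.
have := peval_quad_module_ge0 Kx H1; have := peval_quad_module_ge0 Kx H2.
rewrite /peval mpoly.mevalB mpoly.mevalD mpoly.meval1 => h2 h1.
by rewrite ler_norml; apply/andP; split; lra.
Qed.

(* Shrinking by [r < 1] makes [1 - r P] and [1 + r P] strictly positive on [K]. *)
Lemma shrink_alphas_feasible g phi e N a b r :
  quad_module e g (N%:R - sqnorm_poly R n) ->
  (sup_norm (basic_semialgebraic g) (lin_comb a phi) <= 1)%E ->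
  norm2 a <= b -> 0 <= r < 1 ->
  exists s, alphas_feasible g phi s (r *: a, r * b).
Proof.
move=> HN /sup_norm_le1P HK ab /andP[r0 r1].
have bnd x : (forall i, 0 <= peval (g i) x) ->
    `|peval (lin_comb (r *: a) phi) x| < 1.
  move=> /HK H; rewrite lin_combZ /peval mpoly.mevalZ normrM ger0_norm//.
  by apply: le_lt_trans r1; rewrite ler_piMr.
have [s1 H1] : exists s, quad_module s g (1 - lin_comb (r *: a) phi).
  apply: (putinar_positivstellensatz HN) => x /bnd.
  by rewrite /peval mpoly.mevalB mpoly.meval1 ltr_norml => /andP[]; lra.
have [s2 H2] : exists s, quad_module s g (1 + lin_comb (r *: a) phi).
  apply: (putinar_positivstellensatz HN) => x /bnd.
  by rewrite /peval mpoly.mevalD mpoly.meval1 ltr_norml => /andP[]; lra.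
exists (maxn s1 s2); split=> /=.
- by apply: quad_module_le H1; exact: leq_maxl.
- by apply: quad_module_le H2; exact: leq_maxr.
- by rewrite norm2Z ger0_norm// ler_wpM2l.
Qed.

End Feasibility.

(** * Integrals of polynomials and the bound on the objective *)

Section MomentBound.
Variables (R : realType) (n t : nat) (g : 'I_t -> mpol R n).
Let K := basic_semialgebraic g.

Lemma measurable_peval (D : set (n.-tuple R)) p :
  measurable_fun D (peval p).
Proof.
apply: measurable_funS (@subsetT _ D) _ => //.
elim/mpoly_gen_ind: p => [c|i|p q mp mq|p q mp mq].
- rewrite (_ : peval _ = cst c); first exact: measurable_cst.
  by apply/funext => x; rewrite /peval mpoly.mevalZ mpoly.meval1 mulr1.
- rewrite (_ : peval _ = (@tnth _ _)^~ i); first exact: measurable_tnth.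
  by apply/funext => x; rewrite /peval /pvar mpoly.mevalXU.
- rewrite (_ : peval _ = peval p \+ peval q); first exact: measurable_funD.
  by apply/funext => x; rewrite /peval mpoly.mevalD.
- rewrite (_ : peval _ = peval p \* peval q); first exact: measurable_funM.
  by apply/funext => x; rewrite /peval mpoly.mevalM.
Qed.

Lemma measurable_semialgebraic : measurable K.
Proof.
have -> : K = \bigcap_(i in [set: 'I_t]) [set x | 0 <= peval (g i) x].
  by apply/seteqP; split=> x Kx i => [_|]; exact: Kx.
apply: fin_bigcap_measurable => // i _.
have := @measurable_peval setT (g i) measurableT _ (measurable_itv `[0, +oo[).
rewrite setTI; congr measurable; apply/seteqP.
by split=> x /=; rewrite in_itv/= andbT.
Qed.

Variables (e N : nat).
Hypothesis HN : quad_module e g (N%:R - sqnorm_poly R n).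
Variable mu : {measure set (n.-tuple R) -> \bar R}.
Hypothesis muK : (mu K < +oo)%E.

(** Algebraic rather than topological: k1 - p and k2 + p belong to the quadratic module for suitable
    constants, hence are nonnegative on [K]. *)
Lemma peval_bounded p : exists k : R, forall x, K x -> `|peval p x| <= k.
Proof.
have arch := quad_module_archimedean HN.
have [k1 [e1 H1]] := arch p; have [k2 [e2 H2]] := arch (- p).
exists (`|k1| + `|k2|) => x Kx.
have := peval_quad_module_ge0 Kx H1; have := peval_quad_module_ge0 Kx H2.
rewrite opprK /peval mpoly.mevalB mpoly.mevalD !mpoly.mevalZ !mpoly.meval1 !mulr1.
have := ler_norm k1; have := ler_norm k2.
have := normr_ge0 k1; have := normr_ge0 k2.
by move=> ? ? ? ? ? ?; rewrite ler_norml; apply/andP; split; lra.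
Qed.

Lemma integrable_peval p : mu.-integrable K (EFin \o peval p).
Proof.
apply: measurable_bounded_integrable => //.
- exact: measurable_semialgebraic.
- exact: measurable_peval.
have [k Hk] := peval_bounded p; exists k; split; first exact: num_real.
by move=> k' kk' x Kx /=; exact: le_trans (Hk _ Kx) (ltW kk').
Qed.

Lemma Rintegral_lin_comb T (a : 'rV[R]_T) (phi : 'I_T -> mpol R n) :
  \int[mu]_(x in K) peval (lin_comb a phi) x =
  \sum_i a 0 i * \int[mu]_(x in K) peval (phi i) x.
Proof.
have mK := measurable_semialgebraic.
pose I p := \int[mu]_(x in K) peval p x.
have ID p q : I (p + q) = I p + I q.
  rewrite -RintegralD//; try exact: integrable_peval.
  by apply: eq_Rintegral => x _; rewrite /peval mpoly.mevalD.
have IZ c p : I (c *: p) = c * I p.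
  rewrite -RintegralZl//; last exact: integrable_peval.
  by apply: eq_Rintegral => x _; rewrite /peval mpoly.mevalZ.
have I0 : I 0 = 0 by rewrite -(scale0r 0) IZ mul0r.
rewrite -/(I _) (big_morph I ID I0).
by apply: eq_bigr => i _; rewrite IZ.
Qed.

Lemma objective_le T (phi : 'I_T -> mpol R n) (y eps a : 'rV[R]_T) (delta b : R) :
  0 <= delta -> norm2 eps <= delta ->
  (forall i, y 0 i = \int[mu]_(x in K) peval (phi i) x + eps 0 i) ->
  (sup_norm K (lin_comb a phi) <= 1)%E -> norm2 a <= b ->
  objective y delta (a, b) <= fine (mu K).
Proof.
move=> d0 eps_le hy /sup_norm_le1P HK ab; rewrite /objective /=.
have -> : \sum_i a 0 i * y 0 i =
    \int[mu]_(x in K) peval (lin_comb a phi) x + \sum_i a 0 i * eps 0 i.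
  rewrite Rintegral_lin_comb -big_split; apply: eq_bigr => i _ /=.
  by rewrite hy mulrDr.
have Hint : \int[mu]_(x in K) peval (lin_comb a phi) x <= fine (mu K).
  rewrite -[leRHS]mul1r -Rintegral_cst; last exact: measurable_semialgebraic.
  apply: le_Rintegral.
  - exact: measurable_semialgebraic.
  - exact: integrable_peval.
  - rewrite (_ : EFin \o _ = EFin \o peval (1 : mpol R n)).
      exact: integrable_peval.
    by apply/funext => x; rewrite /= /peval mpoly.meval1.
  - by move=> x Kx; exact: le_trans (ler_norm _) (HK _ Kx).
(* The noise costs at most what the penalty b delta in the objective takes away. *)
have : \sum_i a 0 i * eps 0 i <= b * delta.
  by apply: le_trans (cauchy_schwarz _ _) _; rewrite ler_pM ?norm2_ge0.
lra.
Qed.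

End MomentBound.

Lemma positive_discrete_lty (R : realType) n (K : set (n.-tuple R))
    (mu : {measure set (n.-tuple R) -> \bar R}) (D : set (n.-tuple R)) :
  positive_discrete K mu -> measurable D -> (mu D < +oo)%E.
Proof.
move=> [m [c [x [c0 _ muE]]]] mD; rewrite muE//.
apply: lte_sum_pinfty => j _; rewrite diracE.
by rewrite -EFinM ltry.
Qed.

(** * The optimal values and their limit *)

Section Values.
Variables (R : realType) (n t T : nat) (g : 'I_t -> mpol R n).
Variables (phi : 'I_T -> mpol R n) (y : 'rV[R]_T) (delta : R).
Let K := basic_semialgebraic g.

Lemma alphas_ge0 s : (0 <= alphas g phi y delta s)%E.
Proof.
apply: ereal_sup_ubound; exists (0, 0); first exact: alphas_feasible0.
by rewrite /objective /= mul0r subr0 big1// => i _; rewrite mxE mul0r.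
Qed.

Lemma alphas_le_alpha s : (alphas g phi y delta s <= alpha K phi y delta)%E.
Proof.
apply: ereal_sup_le => _ [[a b] Hab <-]; exists (a, b) => //; split.
  exact: alphas_feasible_sup_norm Hab.
by case: Hab.
Qed.

Lemma alphas_nondecreasing :
  {homo alphas g phi y delta : s1 s2 / (s1 <= s2)%N >-> (s1 <= s2)%E}.
Proof.
move=> s1 s2 s12; apply: ereal_sup_le => _ [ab Hab <-].
by exists ab => //; exact: alphas_feasible_le s12 _ Hab.
Qed.

Variables (e N : nat).
Hypothesis HN : quad_module e g (N%:R - sqnorm_poly R n).
Variable mu : {measure set (n.-tuple R) -> \bar R}.
Hypothesis muK : (mu K < +oo)%E.
Variable eps : 'rV[R]_T.
Hypothesis delta_ge0 : 0 <= delta.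
Hypothesis eps_le : norm2 eps <= delta.
Hypothesis hy : forall i, y 0 i = \int[mu]_(x in K) peval (phi i) x + eps 0 i.

Lemma alpha_le : (alpha K phi y delta <= (fine (mu K))%:E)%E.
Proof.
apply: ge_ereal_sup => _ [[a b] [/= H1 H2] <-]; rewrite lee_fin.
exact: (objective_le HN muK delta_ge0 eps_le hy).
Qed.

Lemma alphas_fin_num s : alphas g phi y delta s \is a fin_num.
Proof.
rewrite ge0_fin_numE ?alphas_ge0//.
exact: le_lt_trans (le_trans (alphas_le_alpha s) alpha_le) (ltry _).
Qed.

Lemma alpha_fin_num : alpha K phi y delta \is a fin_num.
Proof.
rewrite ge0_fin_numE; first exact: le_lt_trans alpha_le (ltry _).
exact: le_trans (alphas_ge0 0) (alphas_le_alpha 0).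
Qed.

(** A nondecreasing sequence tends to its supremum, so it remains to identify this supremum with
    [alpha]; shrunken feasible points give the hard inequality. *)
Lemma alphas_cvg : alphas g phi y delta s @[s --> \oo] --> alpha K phi y delta.
Proof.
have -> : alpha K phi y delta = ereal_sup (range (alphas g phi y delta)).
  apply/eqP; rewrite eq_le; apply/andP; split; last first.
    by apply: ge_ereal_sup => _ [s _ <-]; exact: alphas_le_alpha.
  apply: ge_ereal_sup => _ [[a b] [/= H1 H2] <-].
  set S := ereal_sup _; set v := objective _ _ _.
  have S_ge s : (alphas g phi y delta s <= S)%E by apply: ereal_sup_ubound; exists s.
  have Sfin : S \is a fin_num.
    rewrite ge0_fin_numE; last exact: le_trans (alphas_ge0 0) (S_ge 0%N).
    apply: le_lt_trans (_ : (alpha K phi y delta < +oo)%E).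
      by apply: ge_ereal_sup => _ [s _ <-]; exact: alphas_le_alpha.
    exact: le_lt_trans alpha_le (ltry _).
  have shr r : 0 <= r < 1 -> r * v <= fine S.
    move=> r01; have [s Hs] := shrink_alphas_feasible HN H1 H2 r01.
    rewrite -lee_fin fineK//; apply: le_trans (S_ge s).
    apply: ereal_sup_ubound; exists (r *: a, r * b) => //.
    by rewrite objectiveZ.
  rewrite -(fineK Sfin) lee_fin.
  (* A nonpositive [v] is settled by r = 0, which shows 0 <= S. *)
  have [v_le0|v_gt0] := leP v 0.
    by apply: le_trans v_le0 _; have := shr 0; rewrite mul0r lexx ltr01 => /(_ isT).
  apply/ler_addgt0Pr => d d0.
  have vd : 0 < v + d by rewrite addr_gt0.
  (* This r satisfies r v >= v - d, because v^2 >= (v - d)(v + d). *)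
  have : 0 <= v / (v + d) < 1.
    by rewrite divr_ge0 ?(ltW v_gt0) ?(ltW vd)//= ltr_pdivrMr// mul1r ltrDl.
  move=> /shr H; rewrite -lerBlDr; apply: le_trans H.
  rewrite mulrAC ler_pdivlMr//; have := sqr_ge0 d; rewrite expr2; lra.
exact: ereal_nondecreasing_cvgn alphas_nondecreasing.
Qed.

End Values.

(** * Semidefinite formulation *)

Section RankOneDecomposition.
Variables (R : realType) (k : nat).
Implicit Types (M : 'M[R]_k) (u v : 'rV[R]_k).

Definition qform M v : R := (v *m M *m v^T) 0 0.

Lemma psd_qform_ge0 M v : psd M -> 0 <= qform M v.
Proof. by case=> _; apply. Qed.

Lemma qform_tr M v : qform M v = \tr (v^T *m v *m M).
Proof. by rewrite -mulmxA mxtrace_mulC trace_mx11. Qed.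

(** Moving along one coordinate serves twice: to find a negative value in [psd_diag0], and to
    complete the square in [psd_sum_rank1]. *)
Lemma qform_subZ_delta M v c j : M^T = M ->
  qform M (v - c *: delta_mx 0 j) =
  qform M v - 2 * c * (v *m M) 0 j + c ^+ 2 * M j j.
Proof.
move=> symM; rewrite /qform.
have -> : (v - c *: delta_mx 0 j)^T = v^T - c *: delta_mx j 0.
  by rewrite linearB linearZ /= trmx_delta.
have Ej : (v *m M *m (delta_mx j 0 : 'cV_k)) 0 0 = (v *m M) 0 j by rewrite -colE mxE.
have Ev : ((delta_mx 0 j : 'rV_k) *m M *m v^T) 0 0 = (v *m M) 0 j.
  rewrite -rowE !mxE; apply: eq_bigr => i _.
  by rewrite !mxE mulrC -[in LHS]symM mxE.
have Ejj : ((delta_mx 0 j : 'rV_k) *m M *m (delta_mx j 0 : 'cV_k)) 0 0 = M j j.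
  by rewrite -rowE -colE !mxE.
rewrite -Ejj -Ej in Ev *; rewrite !mulmxBl !mulmxBr -!scalemxAl -!scalemxAr.
move: Ev; move: (v *m M *m v^T) (v *m M *m _) => A B.
move: (_ *m v^T) (_ *m delta_mx j 0) => C D.
by rewrite !mxE => ->; ring.
Qed.

Lemma psd_diag0 M i j : psd M -> M j j = 0 -> M j i = 0.
Proof.
move=> psdM Mjj; have [symM _] := psdM; apply/eqP/negPn/negP => Mji.
(* With [M j j = 0] the form is affine in [c]; this choice gives it the value -1. *)
pose c := (M i i + 1) / (2 * M j i).
have := psd_qform_ge0 (delta_mx 0 i - c *: delta_mx 0 j) psdM.
rewrite qform_subZ_delta// Mjj mulr0 addr0 /qform trmx_delta -rowE -colE !mxE.
have -> : M i j = M j i by rewrite -[in LHS]symM mxE.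
have -> : 2 * c * M j i = M i i + 1 by rewrite /c; field; rewrite Mji.
lra.
Qed.

(** Cholesky elimination: subtracting the rank-one matrix built from the first nonzero row leaves a
    positive semidefinite matrix with one more zero row. *)
Lemma psd_sum_rank1 M : psd M -> exists l : seq 'rV[R]_k, M = \sum_(u <- l) u^T *m u.
Proof.
(* Only the last [d] rows may be nonzero; d = k imposes nothing. *)
suff H d : forall M, psd M -> (forall i i' : 'I_k, (i + d < k)%N -> M i i' = 0) ->
    exists l : seq 'rV[R]_k, M = \sum_(u <- l) u^T *m u.
  by move=> psdM; apply: (H k M psdM) => i i'; rewrite ltnNge leq_addl.
elim: d => [|d IH] {}M psdM M0.
  exists [::]; rewrite big_nil; apply/matrixP => i j.
  by rewrite mxE M0// addn0.
have [kd|dk] := leqP k d.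
  by apply: IH => // i i'; rewrite ltnNge (leq_trans kd (leq_addl _ _)).
have jP : (k - d.+1 < k)%N by rewrite ltn_subrL (leq_trans _ dk).
pose j := Ordinal jP; pose a := M j j.
have [symM _] := psdM.
have a0 : 0 <= a.
  have := psd_qform_ge0 (delta_mx 0 j) psdM.
  by rewrite /qform trmx_delta -rowE -colE !mxE.
have symE i i' : M i i' = M i' i by rewrite -[in LHS]symM mxE.
(* If a = 0 then w = 0 by the convention on inverses, and row [j] already vanishes by
   [psd_diag0]. *)
pose w : 'rV[R]_k := (Num.sqrt a)^-1 *: row j M.
have wE i i' : (w^T *m w) i i' = a^-1 * (M j i * M j i').
  rewrite !mxE big_ord1 !mxE -[in RHS](sqr_sqrtr a0) expr2 invfM; ring.
have [l Hl] : exists l : seq 'rV[R]_k, M - w^T *m w = \sum_(u <- l) u^T *m u.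
  apply: IH => [|i i' Hi].
    split=> [|v]; first by rewrite linearB /= trmx_mul trmxK symM.
    (* The reduced form at [v] is the form of [M] at the point where, if a > 0, it is minimal along
       the line through [v] in direction [j]; hence it is nonnegative. *)
    have -> : (v *m (M - w^T *m w) *m v^T) 0 0 =
        qform M (v - (a^-1 * (v *m M) 0 j) *: delta_mx 0 j).
      rewrite qform_subZ_delta// mulmxBr mulmxBl mulmxA.
      rewrite [in LHS]mxE [in X in _ + X]mxE -[(v *m M *m v^T) 0 0]/(qform M v).
      have wv : (v *m w^T) 0 0 = (Num.sqrt a)^-1 * (v *m M) 0 j.
        rewrite linearZ /= -scalemxAr mxE; congr (_ * _).
        by rewrite !mxE; apply: eq_bigr => i _; rewrite !mxE symE.
      have -> : (v *m w^T *m w *m v^T) 0 0 = a^-1 * (v *m M) 0 j ^+ 2.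
        rewrite -mulmxA mxE big_ord1 -[w *m v^T]trmxK trmx_mul trmxK [_^T 0 0]mxE wv.
        by rewrite -[in RHS](sqr_sqrtr a0) expr2 invfM; ring.
      have [a_eq0|a_neq0] := eqVneq a 0.
        by rewrite a_eq0 invr0; ring.
      by rewrite -/a; field.
    exact: psd_qform_ge0.
  rewrite mxE [in X in _ + X]mxE wE.
  have [ij|ji] := ltnP i j.
    have Mi0 i1 : M i i1 = 0.
      by apply: M0; move: ij; rewrite /= ltn_subRL addnC.
    by rewrite (symE j i) !Mi0 mul0r mulr0 subr0.
  have -> : i = j.
    apply: val_inj; apply/eqP; rewrite eqn_leq ji andbT /=.
    by rewrite leq_subRL// addSn addnC.
  have [a_eq0|a_neq0] := eqVneq a 0.
    by rewrite (psd_diag0 i' psdM a_eq0) mulr0 mulr0 subr0.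
  by rewrite -/a; field.
by exists (w :: l); rewrite big_cons -Hl addrC subrK.
Qed.

Lemma psd_rank1_sum (l : seq 'rV[R]_k) : psd (\sum_(u <- l) u^T *m u).
Proof.
split=> [|v].
  by rewrite raddf_sum; apply: eq_bigr => u _; rewrite /= trmx_mul trmxK.
rewrite mulmx_sumr mulmx_suml summxE sumr_ge0// => u _.
rewrite mulmxA -mulmxA mxE big_ord1 -[u *m v^T]trmxK trmx_mul trmxK [_^T 0 0]mxE.
by rewrite -expr2 sqr_ge0.
Qed.

End RankOneDecomposition.

(** * Semidefinite programs from sums of quadratic forms *)

Section QuadraticSDP.
Variables (R : realType) (k T q : nat).

(** The SDP variable is an arbitrary flattened matrix. Symmetrized matrix units make it enter
    through its symmetric part, as [sdp_F_sym] demands. *)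
Definition sym_delta (p : 'I_(k * k)) : 'M[R]_k :=
  2^-1 *: (vec_mx (delta_mx 0 p) + (vec_mx (delta_mx 0 p))^T).

Lemma tr_sym_delta p : (sym_delta p)^T = sym_delta p.
Proof. by rewrite linearZ linearD /= trmxK addrC. Qed.

Lemma sum_sym_delta (M : 'M[R]_k) : M^T = M ->
  \sum_p mxvec M 0 p *: sym_delta p = M.
Proof.
move=> symM.
have E : \sum_p mxvec M 0 p *: vec_mx (delta_mx 0 p) = M.
  rewrite -[RHS]mxvecK [in RHS](row_sum_delta (mxvec M)) linear_sum.
  by apply: eq_bigr => p _; rewrite linearZ.
have ET : \sum_p mxvec M 0 p *: (vec_mx (delta_mx 0 p))^T = M.
  rewrite -[RHS]symM -[in RHS]E linear_sum.
  by apply: eq_bigr => p _; rewrite linearZ.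
transitivity (2^-1 *: (M + M)); last first.
  by rewrite -mulr2n -[M *+ 2]scaler_nat scalerA mulVf// scale1r.
rewrite -[X in _ *: (X + _)]E -[X in _ *: (_ + X)]ET -big_split scaler_sumr.
by apply: eq_bigr => p _ /=; rewrite -scalerDr !scalerA mulrC.
Qed.

Variables (wc : 'I_q -> 'M[R]_k) (b : 'rV[R]_q) (wa : 'I_T -> 'M[R]_k) (wb : 'M[R]_k).
Variables (y : 'rV[R]_T) (delta : R).

Let La : 'M[R]_(k * k, T) := \matrix_(p, j) \tr (sym_delta p *m wa j).
Let Lb : 'cV[R]_(k * k) := \col_p \tr (sym_delta p *m wb).

Definition quadratic_sdp : sdp R :=
  {| sdp_c := \row_p (\sum_j La p j * y 0 j - Lb p 0 * delta);
     sdp_A := \matrix_(p, c) \tr (sym_delta p *m wc c);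
     sdp_b := b;
     sdp_F0_sym := trmx0 R k k;
     sdp_F_sym := tr_sym_delta |}.

(** A positive semidefinite X is a sum of matrices u^T u, and then tr(X w) is the sum of the values
    [qform w u]. Conditions on families of vectors thus become linear in X. *)
Lemma quadratic_sdp_formulation : sdp_formulation quadratic_sdp
  [set ab : 'rV[R]_T * R | exists l : seq 'rV[R]_k, [/\
     forall c, \sum_(u <- l) qform (wc c) u = b 0 c,
     forall j, ab.1 0 j = \sum_(u <- l) qform (wa j) u &
     ab.2 = \sum_(u <- l) qform wb u]]
  (objective y delta).
Proof.
pose Mx (x : 'rV[R]_(k * k)) := \sum_p x 0 p *: sym_delta p.
have trE w (x : 'rV[R]_(k * k)) : \sum_p x 0 p * \tr (sym_delta p *m w) = \tr (Mx x *m w).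
  rewrite mulmx_suml raddf_sum; apply: eq_bigr => p _ /=.
  by rewrite -scalemxAl mxtraceZ.
have sumE w (l : seq 'rV[R]_k) :
    \tr ((\sum_(u <- l) u^T *m u) *m w) = \sum_(u <- l) qform w u.
  by rewrite mulmx_suml raddf_sum; apply: eq_bigr => u _; rewrite qform_tr.
have feasE (x : 'rV[R]_(k * k)) : sdp_feasible quadratic_sdp x <->
    psd (Mx x) /\ forall c, \tr (Mx x *m wc c) = b 0 c.
  rewrite /sdp_feasible /= add0r; split=> -[psdM H]; split=> //.
    move=> c; rewrite -H mxE -trE; apply: eq_bigr => p _; by rewrite mxE.
  apply/rowP => c; rewrite mxE -H -trE; apply: eq_bigr => p _; by rewrite mxE.
have LaE (x : 'rV[R]_(k * k)) j : (x *m La) 0 j = \tr (Mx x *m wa j).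
  by rewrite mxE -trE; apply: eq_bigr => p _; rewrite mxE.
have LbE (x : 'rV[R]_(k * k)) : (x *m Lb) 0 0 = \tr (Mx x *m wb).
  by rewrite mxE -trE; apply: eq_bigr => p _; rewrite mxE.
exists La, Lb; split=> [|x _].
  apply/seteqP; split=> [_ [x /feasE[/psd_sum_rank1[l Hl] Hc] <-]|[a c] /= [l [Hc Ha Hb]]].
    exists l => /=; split=> [c|j|]; first by rewrite -Hc Hl sumE.
      by rewrite LaE Hl sumE.
    by rewrite LbE Hl sumE.
  pose X := \sum_(u <- l) u^T *m u.
  have MX : Mx (mxvec X) = X by apply: sum_sym_delta; case: (psd_rank1_sum l).
  exists (mxvec X).
    apply/feasE; rewrite MX; split=> [|i]; first exact: psd_rank1_sum.
    by rewrite sumE.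
  congr (_, _); last by rewrite LbE MX sumE.
  by apply/rowP => j; rewrite LaE MX sumE.
rewrite /sdp_obj /objective /=.
under eq_bigr do rewrite mxE mulrBl.
rewrite sumrB; congr (_ - _).
  under [RHS]eq_bigr do rewrite mxE mulr_suml.
  rewrite exchange_big; apply: eq_bigr => p _ /=.
  by rewrite mulr_suml; apply: eq_bigr => j _; ring.
by rewrite mxE mulr_suml; apply: eq_bigr => p _; ring.
Qed.

End QuadraticSDP.

Lemma sdp_formulation_value (R : realType) T (S : sdp R) (D : set ('rV[R]_T * R)) obj :
  sdp_formulation S D obj -> sdp_value S = ereal_sup [set (obj ab)%:E | ab in D].
Proof.
move=> [La [Lb [<- objE]]]; congr ereal_sup; apply/seteqP; split.
  move=> _ [x Sx <-]; rewrite objE//.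
  by exists (x *m La, (x *m Lb) 0 0) => //; exists x.
by move=> _ [_ [x Sx <-] <-]; exists x; rewrite // objE.
Qed.

(** * Vector-valued quadratic maps *)

Section QuadraticMaps.
Variables (R : realType) (I : finType) (V : lmodType R).
Implicit Types (q : (I -> R) -> V).

(** Homogeneous of degree two, so sums of values depend only on the sums of the u_i u_j, linearly.
    [W] may be non-symmetric, which spares symmetrization. *)
Definition is_quadratic q : Prop := exists W : I -> I -> V,
  forall u, q u = \sum_i \sum_j (u i * u j) *: W i j.

Lemma is_quadratic_monomial i j w : is_quadratic (fun u => (u i * u j) *: w).
Proof.
exists (fun i' j' => if (i' == i) && (j' == j) then w else 0) => u.
rewrite (bigD1 i)//= (bigD1 j)//= !eqxx /=.
rewrite big1 ?addr0 => [|j' /negPf ->]; last by rewrite scaler0.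
rewrite big1 ?addr0// => i' /negPf ->.
by rewrite big1// => j' _; rewrite scaler0.
Qed.

Lemma is_quadratic_sum (J : finType) (q : J -> (I -> R) -> V) :
  (forall j, is_quadratic (q j)) -> is_quadratic (fun u => \sum_j q j u).
Proof.
move=> /choice[W qE]; exists (fun i1 i2 => \sum_j W j i1 i2) => u.
under eq_bigr do rewrite qE.
rewrite exchange_big; apply: eq_bigr => i1 _ /=.
rewrite exchange_big; apply: eq_bigr => i2 _ /=.
by rewrite scaler_sumr.
Qed.

Lemma is_quadraticD q1 q2 :
  is_quadratic q1 -> is_quadratic q2 -> is_quadratic (fun u => q1 u + q2 u).
Proof.
move=> Q1 Q2; have := @is_quadratic_sum bool (fun b => if b then q1 else q2).
have H : forall b : bool, is_quadratic (if b then q1 else q2) by case.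
by move=> /(_ H)[W WE]; exists W => u; rewrite -WE big_bool.
Qed.

Lemma is_quadraticZ c q : is_quadratic q -> is_quadratic (fun u => c *: q u).
Proof.
move=> [W qE]; exists (fun i j => c *: W i j) => u.
rewrite qE scaler_sumr; apply: eq_bigr => i _.
rewrite scaler_sumr; apply: eq_bigr => j _.
by rewrite !scalerA mulrC.
Qed.

End QuadraticMaps.

Lemma is_quadratic_mul_sqr (R : realType) (I : finType) (V : comAlgType R)
    (J : finType) (f : J -> I) (v : J -> V) (w : V) :
  is_quadratic (fun u : I -> R => w * (\sum_j u (f j) *: v j) ^+ 2).
Proof.
have [W WE] : is_quadratic (fun u : I -> R =>
    \sum_i \sum_j (u (f i) * u (f j)) *: (w * (v i * v j))).
  by do 2!apply: is_quadratic_sum => ?; exact: is_quadratic_monomial.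
exists W => u; rewrite -WE expr2 mulr_suml mulr_sumr; apply: eq_bigr => i _.
rewrite mulr_sumr mulr_sumr; apply: eq_bigr => j _.
by rewrite -!scalerAl -!scalerAr scalerA.
Qed.

Lemma mcoeff_ge_msize (R : realType) n (p : mpol R n) m :
  (mpoly.msize p <= mpoly.mdeg m)%N -> mpoly.mcoeff m p = 0.
Proof. by move=> /mpoly.msize_mdeg_ge/mpoly.memN_msupp_eq0. Qed.

(** * Polynomial equations as linear constraints on Gram matrices *)

Section PolynomialConstraints.
Variables (R : realType) (n T : nat) (I C : finType).
Variables (Q : C -> (I -> R) -> mpol R n) (B : C -> mpol R n).
Variables (qa : 'I_T -> (I -> R) -> R^o) (qb : (I -> R) -> R^o).
Hypotheses (quadQ : forall c, is_quadratic (Q c)).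
Hypotheses (quadqa : forall j, is_quadratic (qa j)) (quadqb : is_quadratic qb).

(** Comparing coefficients turns each polynomial equation into real equations of the kind handled by
    [quadratic_sdp]. *)
Lemma poly_quadratic_sdp (y : 'rV[R]_T) (delta : R) :
  exists S : sdp R, sdp_formulation S
    [set ab : 'rV[R]_T * R | exists l : seq (I -> R), [/\
       forall c, \sum_(u <- l) Q c u = B c,
       forall j, ab.1 0 j = \sum_(u <- l) qa j u &
       ab.2 = \sum_(u <- l) qb u]]
    (objective y delta).
Proof.
have [W QE] := choice quadQ; have [wa qaE] := choice quadqa; have [wb qbE] := quadqb.
(* All coefficients at monomials of degree at least [d] vanish on both sides, so finitely many
   equations remain. *)
pose d := maxn (\max_c mpoly.msize (B c)) (\max_c \max_i \max_j mpoly.msize (W c i j)).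
pose mat (w : I -> I -> R) : 'M[R]_#|I| := \matrix_(i, j) w (enum_val i) (enum_val j).
pose row (u : I -> R) : 'rV[R]_#|I| := \row_i u (enum_val i).
pose fct (v : 'rV[R]_#|I|) : I -> R := fun i => v 0 (enum_rank i).
have fctK u : fct (row u) = u.
  by apply/funext => i; rewrite /fct mxE enum_rankK.
have matE w v : qform (mat w) v = \sum_i \sum_j fct v i * fct v j * w i j.
  rewrite /qform mxE (reindex (@enum_rank I)) /=; last first.
    exact: onW_bij (enum_rank_bij I).
  rewrite [RHS]exchange_big; apply: eq_bigr => j _ /=.
  rewrite !mxE mulr_suml (reindex (@enum_rank I)) /=; last first.
    exact: onW_bij (enum_rank_bij I).
  by apply: eq_bigr => i _; rewrite !mxE !enum_rankK /fct; ring.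
have dB c m : (d <= mpoly.mdeg m)%N -> mpoly.mcoeff m (B c) = 0.
  rewrite geq_max => /andP[dm _]; apply: mcoeff_ge_msize; apply: leq_trans dm.
  exact: leq_bigmax.
have dW c i j m : (d <= mpoly.mdeg m)%N -> mpoly.mcoeff m (W c i j) = 0.
  rewrite geq_max => /andP[_ dm]; apply: mcoeff_ge_msize; apply: leq_trans dm.
  apply: leq_trans (leq_bigmax c); apply: leq_trans (leq_bigmax i).
  exact: leq_bigmax.
pose J : finType := (C * mpoly.bmultinom n d)%type.
pose wc (p : 'I_#|J|) := let cm := enum_val p in
  mat (fun i j => mpoly.mcoeff cm.2 (W cm.1 i j)).
pose b : 'rV[R]_#|J| := \row_(p < #|J|)
  mpoly.mcoeff (@enum_val J _ p).2 (B (@enum_val J _ p).1).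
exists (quadratic_sdp wc b (fun j => mat (wa j)) (mat wb) y delta).
have coefQ c m (l : seq (I -> R)) : mpoly.mcoeff m (\sum_(u <- l) Q c u) =
    \sum_(u <- l) \sum_i \sum_j u i * u j * mpoly.mcoeff m (W c i j).
  rewrite raddf_sum; apply: eq_bigr => u _ /=; rewrite QE.
  rewrite raddf_sum; apply: eq_bigr => i _ /=.
  rewrite raddf_sum; apply: eq_bigr => j _ /=.
  by rewrite mpoly.mcoeffZ.
have := quadratic_sdp_formulation wc b (fun j => mat (wa j)) (mat wb) y delta.
set D1 := (D in sdp_formulation _ D _ -> _); set D2 := (D in _ -> sdp_formulation _ D _).
suff -> : D1 = D2 by [].
apply/seteqP; split=> [[a r] [l [/= Hc Ha Hb]]|[a r] [l [/= Hc Ha Hb]]].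
  exists (map fct l); split=> [c|j|] /=; last 2 first.
  - by rewrite Ha big_map; apply: eq_bigr => v _; rewrite qaE matE.
  - by rewrite Hb big_map; apply: eq_bigr => v _; rewrite qbE matE.
  apply/mpoly.mpolyP => m; rewrite coefQ big_map.
  have [dm|md] := leqP d (mpoly.mdeg m).
    rewrite dB//; apply: big1 => u _; apply: big1 => i _; apply: big1 => j _.
    by rewrite dW// mulr0.
  have := Hc (enum_rank (c, mpoly.BMultinom md)); rewrite mxE enum_rankK /= => <-.
  by apply: eq_bigr => v _; rewrite /wc enum_rankK matE.
exists (map row l); split=> [p|j|] /=; rewrite big_map.
- rewrite mxE -Hc coefQ; apply: eq_bigr => u _.
  by rewrite matE fctK.
- by rewrite Ha; apply: eq_bigr => u _; rewrite qaE matE fctK.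
- by rewrite Hb; apply: eq_bigr => u _; rewrite qbE matE fctK.
Qed.

End PolynomialConstraints.

Lemma sum_option (V : nmodType) (I : finType) (F : option I -> V) :
  \sum_o F o = F None + \sum_i F (Some i).
Proof.
rewrite (bigD1 None)//=; congr (_ + _).
rewrite (reindex_omap Some id) /=; last by case.
by apply: eq_bigl => i; rewrite eqxx.
Qed.

(** Treats [s0] as the multiplier of an extra weight 1, indexed by [None], and exposes the lists of
    squared polynomials. *)
Lemma quad_moduleP (R : realType) n t (g : 'I_t -> mpol R n) e p :
  quad_module e g p <-> exists L : option 'I_t -> seq (mpol R n),
    (forall o, all (fun h => (mpoly.msize h <= e.+1)%N) (L o)) /\
    p = \sum_o oapp g 1 o * \sum_(h <- L o) h ^+ 2.
Proof.
split=> [[s0 [s [[l0 Hl0 ->] S ->]]]|[L [HL ->]]].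
  have /choice[L HL] : forall i, exists l : seq (mpol R n),
      all (fun h => (mpoly.msize h <= e.+1)%N) l /\ s i = \sum_(h <- l) h ^+ 2.
    by move=> i; have [l Hl El] := S i; exists l.
  exists (oapp L l0); split=> [[i|]//|]; first by have [] := HL i.
  rewrite sum_option /= mul1r; congr (_ + _).
  by apply: eq_bigr => i _; have [_ ->] := HL i.
exists (\sum_(h <- L None) h ^+ 2), (fun i => \sum_(h <- L (Some i)) h ^+ 2).
split=> [|i|]; [by exists (L None) | by exists (L (Some i)) | ].
by rewrite sum_option /= mul1r.
Qed.

Lemma msize_sum_bounded (R : realType) n d (c : mpoly.bmultinom n d -> R) :
  (mpoly.msize (\sum_m c m *: mpoly.mpolyX R (mpoly.bmnm m)) <= d)%N.
Proof.
apply: leq_trans (mpoly.msize_sum _ _ _) _.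
apply/bigmax_leqP_seq => m _ _; apply: leq_trans (mpoly.msizeZ_le _ _) _.
by rewrite mpoly.msizeX mpoly.bmdeg.
Qed.

(** * Gram variables for the truncated problem *)

Section GramParametrization.
Variables (R : realType) (n t T : nat) (g : 'I_t -> mpol R n).
Variables (phi : 'I_T -> mpol R n) (s : nat).

(* The Gram variables: a vector (u_0, u_1, ..., u_T), summing to
   a_j = \sum u_0 u_j and b = \sum |u|^2 / 2, which is possible exactly when
   norm2 a <= b (AM-GM); and, for each of the two signs and each weight
   1, g_1, ..., g_t, the coefficients of a polynomial of degree at most s. *)
Let I : finType := (option 'I_T + bool * option 'I_t * mpoly.bmultinom n s.+1)%type.
Implicit Types (u : I -> R) (c : bool).

Definition gram_poly c (o : option 'I_t) u : mpol R n :=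
  \sum_m u (inr (c, o, m)) *: mpoly.mpolyX R (mpoly.bmnm m).

(** Summing to 1 over a family means that 1 - P (for [c = false]) or 1 + P (for [c = true]) is a
    weighted sum of squares. Writing a_j as u_0 u_j keeps the map homogeneous. *)
Definition gram_constraint c u : mpol R n :=
  (-1) ^+ c *: (\sum_j (u (inl None) * u (inl (Some j))) *: phi j) +
  \sum_o oapp g 1 o * gram_poly c o u ^+ 2.

Definition gram_a (j : 'I_T) u : R^o := (u (inl None) * u (inl (Some j))) *: 1.

Definition gram_b u : R^o :=
  2^-1 *: \sum_o (u (inl o) * u (inl o)) *: (1 : R^o).

Lemma is_quadratic_gram_constraint c : is_quadratic (gram_constraint c).
Proof.
apply: is_quadraticD.
  by apply: is_quadraticZ; apply: is_quadratic_sum => j; exact: is_quadratic_monomial.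
apply: is_quadratic_sum => o.
exact: (is_quadratic_mul_sqr (fun m => inr (c, o, m)) _ _).
Qed.

Lemma is_quadratic_gram_a j : is_quadratic (gram_a j).
Proof. exact: is_quadratic_monomial. Qed.

Lemma is_quadratic_gram_b : is_quadratic gram_b.
Proof.
by apply: is_quadraticZ; apply: is_quadratic_sum => o; exact: is_quadratic_monomial.
Qed.

Lemma sum_gram_constraint c (l : seq (I -> R)) :
  \sum_(u <- l) gram_constraint c u =
  (-1) ^+ c *: lin_comb (\row_j \sum_(u <- l) gram_a j u) phi +
  \sum_o oapp g 1 o * \sum_(h <- [seq gram_poly c o u | u <- l]) h ^+ 2.
Proof.
rewrite big_split -scaler_sumr exchange_big; congr (_ *: _ + _).
  apply: eq_bigr => j _; rewrite mxE scaler_suml; apply: eq_bigr => u _.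
  by rewrite /gram_a [_ *: 1]mulr1.
rewrite exchange_big; apply: eq_bigr => o _.
by rewrite big_map mulr_sumr.
Qed.

(** Pairing with [a]: writing v for (u_1, ..., u_T), |a|^2 is the sum of the <u_0 v, a>, each at
    most |u_0| |v| |a|, hence at most (u_0^2 + |v|^2) |a| / 2. These bounds add up to b |a|. *)
Lemma gram_norm_le (a : 'rV[R]_T) b (l : seq (I -> R)) :
  (forall j, a 0 j = \sum_(u <- l) gram_a j u) -> b = \sum_(u <- l) gram_b u ->
  norm2 a <= b.
Proof.
move=> aE bE.
have gram_bE u : gram_b u =
    2^-1 * (u (inl None) ^+ 2 + norm2 (\row_j u (inl (Some j))) ^+ 2).
  rewrite /gram_b sum_option sqr_norm2; congr (_ * (_ + _)).
    by rewrite [_ *: 1]mulr1.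
  by apply: eq_bigr => j _; rewrite [_ *: 1]mulr1 mxE.
have b0 : 0 <= b.
  rewrite bE sumr_ge0// => u _; rewrite gram_bE mulr_ge0// addr_ge0// sqr_ge0//.
have [->//|a_neq0] := eqVneq (norm2 a) 0.
have a0 : 0 < norm2 a by rewrite lt_def a_neq0 norm2_ge0.
rewrite -(ler_pM2r a0) -expr2 sqr_norm2.
have -> : \sum_i a 0 i ^+ 2 =
    \sum_(u <- l) \sum_j (u (inl None) *: \row_i u (inl (Some i))) 0 j * a 0 j.
  rewrite exchange_big; apply: eq_bigr => j _.
  rewrite expr2 {1}aE mulr_suml; apply: eq_bigr => u _.
  by rewrite !mxE /gram_a [_ *: 1]mulr1.
rewrite bE mulr_suml; apply: ler_sum => u _.
apply: le_trans (cauchy_schwarz _ _) _; rewrite ler_pM2r// gram_bE norm2Z.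
set w := norm2 _; rewrite -(normr_id (u _)) -[_ ^+ 2 in leRHS]real_normK ?num_real//.
rewrite normr_id; have := sqr_ge0 (`|u (inl None)| - w); lra.
Qed.

(** Encodes a single square in the block of sign [c] and weight [o]; the zero [inl] coordinates keep
    it from contributing to a and b. *)
Definition gram_embed c (o : option 'I_t) (h : mpol R n) : I -> R := fun i =>
  if i is inr (c', o', m) then
    if (c' == c) && (o' == o) then mpoly.mcoeff (mpoly.bmnm m) h else 0
  else 0.

Lemma gram_poly_embed c o c' o' h : (mpoly.msize h <= s.+1)%N ->
  gram_poly c o (gram_embed c' o' h) = if (c == c') && (o == o') then h else 0.
Proof.
move=> hs; rewrite /gram_poly /=; case: ifP => _; first by rewrite -mpoly.mpolywE.
by rewrite big1// => m _; rewrite scale0r.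
Qed.

Lemma alphas_feasible_gramE : alphas_feasible g phi s =
  [set ab : 'rV[R]_T * R | exists l : seq (I -> R), [/\
     forall c, \sum_(u <- l) gram_constraint c u = 1,
     forall j, ab.1 0 j = \sum_(u <- l) gram_a j u &
     ab.2 = \sum_(u <- l) gram_b u]].
Proof.
apply/seteqP; split=> [[a b]|[a b] /= [l [Hc Ha Hb]]]; last first.
  have aE : a = \row_j \sum_(u <- l) gram_a j u by apply/rowP => j; rewrite mxE.
  have Hq c : quad_module s g (1 - (-1) ^+ c *: lin_comb a phi).
    apply/quad_moduleP; exists (fun o => [seq gram_poly c o u | u <- l]).
    split=> [k|]; last first.
      by rewrite -[X in X - _](Hc c) sum_gram_constraint -aE addrAC subrr add0r.
    by apply/allP => _ /mapP[u _ ->]; exact: msize_sum_bounded.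
  split=> /=; last exact: gram_norm_le Ha Hb.
    by have := Hq false; rewrite scale1r.
  by have := Hq true; rewrite scaleN1r opprK.
case=> [] /= /quad_moduleP[L0 [HL0 E0]] /quad_moduleP[L1 [HL1 E1]] ab.
pose L c := if c then L1 else L0.
have HL c o h : h \in L c o -> (mpoly.msize h <= s.+1)%N.
  by case: c => hL; [exact: (allP (HL1 o)) | exact: (allP (HL0 o))].
have LE c : 1 - (-1) ^+ c *: lin_comb a phi =
    \sum_o oapp g 1 o * \sum_(h <- L c o) h ^+ 2.
  by case: c; rewrite /= ?scaleN1r ?opprK// scale1r.
pose r := norm2 a.
have r0 : 0 <= r by exact: norm2_ge0.
(* Contributes the slack b - |a| to b and nothing else. *)
pose u1 : I -> R := fun i => if i is inl None then Num.sqrt (2 * (b - r)) else 0.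
(* The equality case of AM-GM: it produces all of [a] and exactly r = |a| in b. For r = 0 both [a]
   and this vector vanish. *)
pose u2 : I -> R := fun i => match i with
  | inl None => Num.sqrt r | inl (Some j) => a 0 j / Num.sqrt r | inr _ => 0 end.
pose l := u1 :: u2 ::
  [seq gram_embed co.1 co.2 h | co <- enum {: bool * option 'I_t}, h <- L co.1 co.2].
have sumlE (V : zmodType) (F : (I -> R) -> V) :
    \sum_(u <- l) F u = F u1 + (F u2 +
      \sum_(co : bool * option 'I_t) \sum_(h <- L co.1 co.2) F (gram_embed co.1 co.2 h)).
  by rewrite !big_cons big_allpairs_dep big_enum.
have au2 j : gram_a j u2 = a 0 j.
  rewrite /gram_a /= [_ *: 1]mulr1 mulrC.
  have [r_eq0|r_neq0] := eqVneq r 0.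
    by rewrite (norm2_eq0 r_eq0) mxE mul0r mul0r.
  by rewrite divfK// sqrtr_eq0 -ltNge lt_def r_neq0.
have aE j : a 0 j = \sum_(u <- l) gram_a j u.
  rewrite sumlE au2 /gram_a /= mulr0 scale0r add0r.
  rewrite big1 ?addr0// => co _; rewrite big1// => h _.
  by rewrite mulr0 scale0r.
have sqrt_r2 : Num.sqrt r * Num.sqrt r = r by rewrite -expr2 sqr_sqrtr.
exists l; split=> [c|//|] /=; rewrite sumlE.
  have -> : gram_constraint c u1 = 0.
    rewrite /gram_constraint big1 ?scaler0 ?add0r => [|j _]; last first.
      by rewrite /= mulr0 scale0r.
    rewrite big1// => o _; rewrite /gram_poly big1 ?expr0n ?mulr0// => m _.
    by rewrite scale0r.
  have -> : gram_constraint c u2 = (-1) ^+ c *: lin_comb a phi.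
    rewrite /gram_constraint [X in _ + X]big1 ?addr0 => [|k _]; last first.
      by rewrite /gram_poly big1 ?expr0n ?mulr0// => m _; rewrite scale0r.
    congr (_ *: _); apply: eq_bigr => j _; rewrite -au2 /gram_a.
    by rewrite [(_ *: 1 : R^o)]mulr1.
  (* An embedded square is seen only by the constraint of its own sign, through its own weight. *)
  have embE c' o h : h \in L c' o -> gram_constraint c (gram_embed c' o h) =
      if c == c' then oapp g 1 o * h ^+ 2 else 0.
    move=> /HL hs; rewrite /gram_constraint big1 ?scaler0 ?add0r => [|j _]; last first.
      by rewrite /= mulr0 scale0r.
    have [->|cc'] := eqVneq c c'.
      rewrite (bigD1 o)//= gram_poly_embed// !eqxx /= big1 ?addr0// => o' /negPf oo'.
      by rewrite gram_poly_embed// oo' andbF expr0n mulr0.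
    by rewrite big1// => o' _; rewrite gram_poly_embed// (negPf cc') expr0n mulr0.
  rewrite add0r (eq_bigr (fun co => if c == co.1 then
    oapp g 1 co.2 * \sum_(h <- L co.1 co.2) h ^+ 2 else 0)) => [|[c' o] _ /=]; last first.
    rewrite big_seq (eq_bigr _ (fun h => embE c' o h)) -big_seq.
    by case: ifP => _; rewrite ?mulr_sumr// big1.
  rewrite -(pair_bigA _ (fun c' o => if c == c' then
    oapp g 1 o * \sum_(h <- L c' o) h ^+ 2 else 0)) /=.
  rewrite (bigD1 c)//= eqxx [X in _ + (_ + X)]big1 ?addr0 => [|c' /negPf cc'].
    by rewrite -LE addrC subrK.
  by rewrite eq_sym cc' big1.
rewrite [X in _ + (_ + X)]big1 ?addr0 => [|co _]; last first.
  rewrite big1// => h _; rewrite /gram_b big1 ?scaler0// => o _.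
  by rewrite /= mulr0 scale0r.
rewrite /gram_b !sum_option /= [X in _ *: (_ + X) + _]big1 ?addr0 => [|j _]; last first.
  by rewrite mulr0 scale0r.
have br : 0 <= 2 * (b - r) by rewrite mulr_ge0// subr_ge0.
rewrite -expr2 sqr_sqrtr// sqrt_r2.
have -> : \sum_i (a 0 i / Num.sqrt r * (a 0 i / Num.sqrt r)) *: (1 : R^o) = r.
  transitivity (r ^+ 2 / r).
    rewrite /r sqr_norm2 -/r mulr_suml; apply: eq_bigr => j _.
    rewrite [_ *: 1]mulr1 -[in RHS]sqrt_r2 invfM; ring.
  have [->|r_neq0] := eqVneq r 0; first by rewrite expr0n mul0r.
  by rewrite expr2 mulfK.
rewrite ![_ *: (1 : R^o)]mulr1.
change (b = 2^-1 * (2 * (b - r)) + 2^-1 * (r + r) :> R); by field.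
Qed.

End GramParametrization.

(** Feasibility of (0, 0) and the bound by mu(K) make the extended-real suprema finite, so the SDP
    values and the limit are real numbers. *)
Theorem theorem1p6 (R : realType) (n t T : nat)
    (g : 'I_t -> mpol R n) (K : set (n.-tuple R))
    (hK : K = [set x | forall i, 0 <= peval (g i) x])
    (hN : exists N e : nat, [/\ (0 < N)%N, (0 < e)%N &
       quad_module e g (N%:R - sqnorm_poly R n)])
    (V : set (mpol R n)) (phi : 'I_T -> mpol R n) (hphi : is_basis V phi)
    (delta : R) (hdelta : 0 <= delta)
    (mu : {measure set (n.-tuple R) -> \bar R}) (hmu : positive_discrete K mu)
    (y eps : 'rV[R]_T)
    (hy : forall i, y 0 i = \int[mu]_(x in K) peval (phi i) x + eps 0 i)
    (heps : norm2 eps <= delta) :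
  (forall s : nat, (0 < s)%N ->
     alphas g phi y delta s \is a fin_num /\
     exists S : sdp R,
       sdp_formulation S (alphas_feasible g phi s) (objective y delta) /\
       sdp_value S = alphas g phi y delta s) /\
  (alpha K phi y delta \is a fin_num /\
   alphas g phi y delta s @[s --> \oo] --> alpha K phi y delta).
Proof.
have [N [e [_ _ HN]]] := hN.
have muK : (mu K < +oo)%E.
  by apply: positive_discrete_lty hmu _; rewrite hK; exact: measurable_semialgebraic.
rewrite (hK : K = basic_semialgebraic g) in muK hy *; split; last first.
  split; first exact: (alpha_fin_num HN muK hdelta heps hy).
  exact: (alphas_cvg HN muK hdelta heps hy).
move=> s _; split; first exact: (alphas_fin_num HN muK hdelta heps hy).
have [S HS] := poly_quadratic_sdp (fun=> 1) (is_quadratic_gram_constraint g phi s)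
  (@is_quadratic_gram_a R n t T s) (@is_quadratic_gram_b R n t T s) y delta.
rewrite -alphas_feasible_gramE in HS.
by exists S; split=> //; exact: sdp_formulation_value HS.
Qed.
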